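(* Let $\Omega \subseteq \mathbb{C}$ be an open set and $F\subseteq \mathbb{N}_0$ be a non-empty set. Then the set $S_{\mathcal{A}_{F}(\Omega)}$ of functions in $\mathcal{A}_{F}(\Omega)$ which are non-extendable is either empty, or a dense and $G_\delta$ subset of $\mathcal{A}_{F}(\Omega)$ (with respect to its natural topology).
   Context: $\mathbb{N}_0=\{0,1,2,\dots\}$. For an open set $\Omega\subseteq\mathbb{C}$, $H(\Omega)$ is the set of holomorphic functions on $\Omega$, and $\mathcal{A}(\Omega)$ is the set of those $f\in H(\Omega)$ possessing a continuous extension on $\overline{\Omega}$, the closure being taken in $\mathbb{C}$; the extension is denoted by the same symbol. For non-empty $F\subseteq\mathbb{N}_0$, $\mathcal{A}_F(\Omega)=\{f\in H(\Omega): f^{(l)}\in\mathcal{A}(\Omega) \text{ for all } l\in F\}$. Let $\Omega_i$, $i\in I$ ($I$ finite or $I=\mathbb{N}$), be the connected components of $\Omega$ and fix a point $z_i\in\Omega_i$ for each $i\in I$. The natural topology of $\mathcal{A}_F(\Omega)$ is the one induced by the seminorms $\sup_{z\in\overline{\Omega},\,|z|\leqslant n}|f^{(l)}(z)|$, $l\in F$, $n\in\mathbb{N}$, and $|f^{(l)}(z_i)|$, $0\leqslant l<\min F$, $i\in I$. A holomorphic function $f:\Omega\to\mathbb{C}$ is called extendable (in the sense of Riemann surfaces) if there exist two open discs $D_1, D_2$ with $D_2\cap\Omega\neq\varnothing$, $D_2\cap\Omega^c\neq\varnothing$ and $D_1\subseteq\overline{D_1}\subseteq D_2\cap\Omega$,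 and a (bounded) holomorphic function $g:D_2\to\mathbb{C}$ such that $g|_{D_1}=f|_{D_1}$ (requiring $g$ to be bounded or not gives equivalent definitions). Otherwise $f$ is called non-extendable. *)

(* Defs.v *)
From HB Require Import structures.
From mathcomp Require Import all_boot all_order all_algebra.
From mathcomp Require Import complex.
From mathcomp Require Import all_classical all_reals all_analysis borel_hierarchy.
Set Implicit Arguments.
Unset Strict Implicit.
Unset Printing Implicit Defensive.
Import Order.TTheory GRing.Theory Num.Theory.
Import numFieldNormedType.Exports.
Local Open Scope ring_scope.
Local Open Scope classical_set_scope.
Local Open Scope complex_scope.

(* Typing R[i] as a numFieldType gives it the topology and norm of a field
   over itself, so that derivable and derive1n on C -> C are complex. *)
Definition Cplx (R : realType) : numFieldType := R[i].

(* The norm of the numFieldType Cplx R takes its values in Cplx R. *)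
Definition cmod (R : realType) (z : Cplx R) : R := complex.Re `|z|.

Definition disc (R : realType) (c : Cplx R) (r : R) : set (Cplx R) :=
  ball c (r%:C : Cplx R).

Section FunctionSpaces.
Context {R : realType}.
Local Notation C := (Cplx R).
Implicit Types (W : set C) (F : set nat) (f g : C -> C).

(* A function on an open set W is represented by a total function C -> C;
   on W, derivatives only depend on the values on W. *)
Definition holomorphic W f := forall z, W z -> derivable f z 1.

Definition cont_extension W f g :=
  {within closure W, continuous g} /\ (forall z, W z -> g z = f z).

Definition holo_cont W f :=
  holomorphic W f /\ exists g, cont_extension W f g.

(* The continuous extension to closure W, unique there when it exists; its
   values outside closure W are arbitrary. *)
Definition ext W f : C -> C := xget (fun=> 0) [set g | cont_extension W f g].

(* Functions on W are represented by their extension by 0 to C, so that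
   equality of representatives is equality on W. *)
Definition AF W F : set (C -> C) :=
  [set f | [/\ holomorphic W f,
               (forall l, F l -> holo_cont W (derive1n l f))
             & (forall z, ~ W z -> f z = 0)]].

(* Ω_i = Om i and z_i = z i for i \in I. *)
Definition component_points W (I : set nat) (Om : nat -> set C)
    (z : nat -> C) :=
  [/\ finite_set I \/ I = setT,
      set_bij I [set connected_component W w | w in W] Om
    & forall i, I i -> Om i (z i)].

Definition sup_seminorm W (l n : nat) f : R :=
  sup [set cmod (ext W (derive1n l f) w)
      | w in [set w | closure W w /\ cmod w <= n%:R]].

Definition point_seminorm (z : C) (l : nat) f : R := cmod (derive1n l f z).

(* [forall k, F k -> l < k] says that l < min F. *)
Definition AF_seminorms W F (I : set nat) (z : nat -> C) :
    set ((C -> C) -> R) :=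
  [set p | (exists l n, [/\ F l, (0 < n)%N & p = sup_seminorm W l n]) \/
           (exists l i, [/\ (forall k, F k -> (l < k)%N), I i
                          & p = point_seminorm (z i) l])].

Definition AF_space W F (I : set nat) (z : nat -> C) : Type :=
  set_type (AF W F).

Definition extendable W f :=
  exists c1 r1 c2 r2,
    [/\ 0 < r1, 0 < r2,
        disc c2 r2 `&` W !=set0 /\ disc c2 r2 `&` ~` W !=set0,
        closure (disc c1 r1) `<=` disc c2 r2 `&` W
      & exists g, holomorphic (disc c2 r2) g /\
                  (forall z, disc c1 r1 z -> g z = f z)].

End FunctionSpaces.

HB.instance Definition _ (R : realType) (W : set (Cplx R)) (F I : set nat)
  (z : nat -> Cplx R) := Choice.on (AF_space W F I z).

(* The sub-base of the topology induced by the seminorms: the balls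
   {g | p (g - f) < e}, indexed by the triples (p, f, e). *)
HB.instance Definition _ (R : realType) (W : set (Cplx R)) (F I : set nat)
    (z : nat -> Cplx R) :=
  isSubBaseTopological.Build (AF_space W F I z)
    [set pfe : ((Cplx R -> Cplx R) -> R) * (Cplx R -> Cplx R) * R |
      [/\ AF_seminorms W F I z pfe.1.1, AF W F pfe.1.2 & 0 < pfe.2]]
    (fun pfe => [set g | pfe.1.1 (set_val g \- pfe.1.2) < pfe.2]).

Definition nonextendable (R : realType) (W : set (Cplx R)) (F I : set nat)
    (z : nat -> Cplx R) : set (AF_space W F I z) :=
  [set f | ~ extendable W (set_val f)].
Arguments nonextendable {R} W F I z _.

(* Main.v *)
(* A function f holomorphic on Omega is extendable iff, for some point a of
   Omega with rational coordinates, some rational rho such that the disc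
   D(a, rho) is not contained in Omega, and some M, one has
   |f^(k)(a)| rho^k <= M k! for all k: from an extension g to a disc D2 one
   moves to a boundary point b in D2 of the set where f = g (the identity
   theorem shows that b is not in Omega) and takes a close to b; conversely
   the Taylor series of f at a converges on D(a, rho).

   Each f |-> f^(k)(a) is continuous on A_F(Omega): for k = min F this is one of
   the seminorms, for smaller k one integrates from the base point of the
   component, and for larger k one uses Cauchy's estimates. Hence the functions
   satisfying the condition for a given (a, rho, M) form a closed set, and S is
   a countable intersection of open sets.

   For the density no completeness is needed. If f0 is non-extendable, then for
   each of the countably many (a, rho) the functions satisfying the condition
   for some M form a linear subspace that does not contain f0, so at most one
   real t puts f + t f0 in it; all but countably many small t are good.

   Derivability only means complex differentiability at each point, so that
   Goursat's theorem is needed. It is proved on rectangles, and Cauchy's formula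
   on squares, where the constant 2 i pi only has to be known to be nonzero. *)
Require Import Defs.
From mathcomp Require Import all_boot all_order all_algebra.
From mathcomp Require Import complex.
From mathcomp Require Import all_classical all_reals all_analysis borel_hierarchy.
From mathcomp Require Import ring lra zify finmap.
Set Implicit Arguments.
Unset Strict Implicit.
Unset Printing Implicit Defensive.
Import Order.TTheory GRing.Theory Num.Theory.
Import numFieldNormedType.Exports.
Local Open Scope ring_scope.
Local Open Scope classical_set_scope.
Local Open Scope complex_scope.
Local Notation Re := complex.Re.
Local Notation Im := complex.Im.

(** * The complex modulus *)

Section ComplexModulus.
Context {R : realType}.
Local Notation C := (Cplx R).
Implicit Types z w : C.

(** The bound M belongs to the index because an inequality on a single coefficient is a closed
    condition, which mere convergence of the Taylor series on D(a, rho) is not; only one evaluation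
    functional at a time then has to be continuous.

    The integral of a real function is defined as the increment of a primitive on the whole line.
    This makes subdivision of contours algebraic, but forces integrands to be continuous on entire
    lines, so a function known on a disc is first composed with a retraction onto a square. The
    composite is differentiable only relative to the square, and the difference quotient of f at z
    is at first only known to be continuous at z: Goursat's theorem is therefore stated with
    relative derivatives and an exceptional point.

    The Taylor expansion comes from the vanishing integral of that difference quotient by a finite
    geometric expansion with remainder, so no limit is exchanged with an integral. Real and
    imaginary parts are estimated separately, which costs factors 2 that do no harm. *)

Lemma ReD z w : Re (z + w) = Re z + Re w. Proof. by destruct z, w. Qed.
Lemma ImD z w : Im (z + w) = Im z + Im w. Proof. by destruct z, w. Qed.
Lemma ReN z : Re (- z) = - Re z. Proof. by destruct z. Qed.
Lemma ImN z : Im (- z) = - Im z. Proof. by destruct z. Qed.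
Lemma ReM z w : Re (z * w) = Re z * Re w - Im z * Im w.
Proof. by destruct z, w. Qed.
Lemma ImM z w : Im (z * w) = Re z * Im w + Im z * Re w.
Proof. by destruct z, w. Qed.

Definition ReImE := (ReD, ImD, ReN, ImN, ReM, ImM).

Lemma complex_eqP z w : Re z = Re w -> Im z = Im w -> z = w.
Proof. by destruct z, w => /= -> ->. Qed.

Lemma normE z : `|z| = (cmod z)%:C :> C.
Proof. by rewrite /cmod normc_def. Qed.

Lemma cmod_sqrt z : cmod z = Num.sqrt (Re z ^+ 2 + Im z ^+ 2).
Proof. by rewrite /cmod normc_def. Qed.

Lemma cmod_ge0 z : 0 <= cmod z.
Proof. by rewrite cmod_sqrt sqrtr_ge0. Qed.

Lemma cmodD z w : cmod (z + w) <= cmod z + cmod w.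
Proof. by have := ler_normD z w; rewrite !normE -rmorphD /= lecR. Qed.

Lemma cmodM z w : cmod (z * w) = cmod z * cmod w.
Proof. by have := normrM z w; rewrite !normE -rmorphM /= => /complexI. Qed.

Lemma cmodN z : cmod (- z) = cmod z.
Proof. by rewrite /cmod normrN. Qed.

Lemma cmodBC z w : cmod (z - w) = cmod (w - z).
Proof. by rewrite -opprB cmodN. Qed.

Lemma cmodB z w : cmod (z - w) <= cmod z + cmod w.
Proof. by rewrite -(cmodN w) cmodD. Qed.

Lemma cmodV z : cmod z^-1 = (cmod z)^-1.
Proof. by have := normfV z; rewrite !normE -fmorphV /= => /complexI. Qed.

Lemma cmodX z n : cmod (z ^+ n) = cmod z ^+ n.
Proof. by have := normrX n z; rewrite !normE -rmorphXn /= => /complexI. Qed.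

Lemma cmod_eq0 z : (cmod z == 0) = (z == 0).
Proof. by rewrite -(normr_eq0 z) normE (inj_eq (@complexI R)). Qed.

Lemma cmod_gt0 z : (0 < cmod z) = (z != 0).
Proof. by rewrite lt_def cmod_ge0 andbT cmod_eq0. Qed.

Lemma cmod0 : cmod (0 : C) = 0.
Proof. by apply/eqP; rewrite cmod_eq0. Qed.

Lemma cmod_real (r : R) : cmod (r%:C : C) = `|r|.
Proof. by rewrite cmod_sqrt /= expr0n addr0 sqrtr_sqr. Qed.

Lemma cmod1 : cmod (1 : C) = 1.
Proof. by rewrite (@cmod_real 1) normr1. Qed.

Lemma cmodi : cmod ('i : C) = 1.
Proof. by rewrite cmod_sqrt /= expr0n expr1n add0r sqrtr1. Qed.

Lemma cmod_nat n : cmod (n%:R : C) = n%:R.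
Proof. by have := normr_nat C n; rewrite normE -(rmorph_nat (real_complex R)) => /complexI. Qed.

Lemma Re_le_cmod z : `|Re z| <= cmod z.
Proof. by rewrite cmod_sqrt -sqrtr_sqr ler_wsqrtr// lerDl sqr_ge0. Qed.

Lemma Im_le_cmod z : `|Im z| <= cmod z.
Proof. by rewrite cmod_sqrt -sqrtr_sqr ler_wsqrtr// lerDr sqr_ge0. Qed.

Lemma complexReIm z : z = (Re z)%:C + 'i * (Im z)%:C.
Proof. by destruct z; apply: complex_eqP => /=; ring. Qed.

Lemma cmod_le_ReIm z : cmod z <= `|Re z| + `|Im z|.
Proof.
rewrite {1}(complexReIm z); apply: le_trans (cmodD _ _) _.
by rewrite cmodM cmodi mul1r !cmod_real.
Qed.

Lemma cmod_sum (I : Type) (r : seq I) (P : pred I) (F : I -> C) :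
  cmod (\sum_(i <- r | P i) F i) <= \sum_(i <- r | P i) cmod (F i).
Proof.
elim/big_ind2 : _ => [|x a y b xa yb|//]; first by rewrite cmod0.
exact: le_trans (cmodD _ _) (lerD xa yb).
Qed.

Lemma discE (c : C) (r : R) : disc c r = [set z | cmod (z - c) < r].
Proof.
by apply/seteqP; split=> z; rewrite /disc /= -ball_normE /= cmodBC normE ltcR.
Qed.

Lemma cnbhsP z (P : set C) :
  nbhs z P <-> exists2 e : R, 0 < e & forall w, cmod (w - z) < e -> P w.
Proof.
split=> [/nbhs_ballP[e /= e0 eP]|[e e0 eP]].
(* The radius of a ball lies in [Cplx R]; being positive there, it is real. *)
- have eE : e = (Re e)%:C.
    by move: e0; rewrite ltcE /= => /andP[/eqP ie _]; case: (e) ie => a b /= ->.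
  exists (Re e); first by move: e0; rewrite ltcE /= => /andP[].
  move=> w wz; apply: eP; rewrite eE.
  by have := discE z (Re e); rewrite /disc => ->.
- apply/nbhs_ballP; exists e%:C => /=; first by rewrite ltcR.
  by move=> w; have := discE z e; rewrite /disc => -> /eP.
Qed.

Lemma copenP (W : set C) :
  open W <-> forall z, W z -> exists2 e : R, 0 < e & disc z e `<=` W.
Proof.
rewrite openE; split=> [oW z /oW /cnbhsP[e e0 eW]|oW z /oW[e e0 eW]].
- by exists e => // w; rewrite discE => /eW.
- by apply/cnbhsP; exists e => // w wz; apply: eW; rewrite discE.
Qed.

Lemma disc_open (c : C) (r : R) : open (disc c r).
Proof.
apply/copenP => z; rewrite !discE /= => zr.
exists (r - cmod (z - c)); first by rewrite subr_gt0.
move=> w; rewrite discE /= => wz.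
rewrite -(subrK z w) -addrA; apply: le_lt_trans (cmodD _ _) _; lra.
Qed.

Lemma ccontP (T : topologicalType) (f : T -> C) (x : T) :
  {for x, continuous f} <->
  forall e : R, 0 < e -> \forall y \near x, cmod (f y - f x) < e.
Proof.
split=> [fx e e0|H].
- have /fx : nbhs (f x) [set w | cmod (w - f x) < e] by apply/cnbhsP; exists e.
  by [].
- move=> A /cnbhsP[e e0 eA]; near=> y; apply: eA; near: y.
  exact: H.
Unshelve. all: by end_near. Qed.

Lemma rcontP (T : topologicalType) (f : T -> R) (x : T) :
  {for x, continuous f} <->
  forall e : R, 0 < e -> \forall y \near x, `|f y - f x| < e.
Proof.
split=> [/cvgrPdist_lt fx e /fx|H].
- by apply: filterS => y; rewrite distrC.
- by apply/cvgrPdist_lt => e /H; apply: filterS => y; rewrite distrC.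
Qed.

Lemma Re_continuous : continuous (@Re R : C -> R).
Proof.
move=> z; apply/rcontP => e e0; apply/cnbhsP; exists e => // w wz.
by rewrite -ReN -ReD; apply: le_lt_trans (Re_le_cmod _) _.
Qed.

Lemma Im_continuous : continuous (@Im R : C -> R).
Proof.
move=> z; apply/rcontP => e e0; apply/cnbhsP; exists e => // w wz.
by rewrite -ImN -ImD; apply: le_lt_trans (Im_le_cmod _) _.
Qed.

Lemma cmod_continuous : continuous (@cmod R).
Proof.
move=> z; apply/rcontP => e e0; apply/cnbhsP; exists e => // w wz.
apply: le_lt_trans wz; rewrite ler_norml; apply/andP; split.
- by have := cmodD (z - w) w; rewrite subrK (cmodBC z w); lra.
- by have := cmodD (w - z) z; rewrite subrK; lra.
Qed.

Lemma ccont_ReIm (T : topologicalType) (f : T -> C) :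
  continuous (fun x => Re (f x)) -> continuous (fun x => Im (f x)) ->
  continuous f.
Proof.
move=> cr ci x; apply/ccontP => e e0.
have e2 : 0 < e / 2 by lra.
have /rcontP/(_ _ e2) Hr := cr x.
have /rcontP/(_ _ e2) Hi := ci x.
near=> y.
apply: le_lt_trans (cmod_le_ReIm _) _; rewrite !ReImE.
have -> : e = e/2 + e/2 by lra.
by apply: ltrD; near: y.
Unshelve. all: by end_near. Qed.

Lemma ccontD (T : topologicalType) (f g : T -> C) :
  continuous f -> continuous g -> continuous (fun x => f x + g x).
Proof. by move=> cf cg x; exact: cvgD (cf x) (cg x). Qed.

Lemma ccontM (T : topologicalType) (f g : T -> C) :
  continuous f -> continuous g -> continuous (fun x => f x * g x).
Proof. by move=> cf cg x; exact: cvgM (cf x) (cg x). Qed.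

Lemma ccontX (T : topologicalType) (f : T -> C) n :
  continuous f -> continuous (fun x => f x ^+ n).
Proof.
move=> cf; elim: n => [|n IH]; first by move=> x; exact: cvg_cst.
have -> : (fun x => f x ^+ n.+1) = (fun x => f x * f x ^+ n).
  by apply/funext => x; rewrite exprS.
exact: ccontM.
Qed.

Lemma ccont_cst (T : topologicalType) (c : C) : continuous (fun _ : T => c).
Proof. by move=> x; exact: cvg_cst. Qed.

Lemma ccont_real (T : topologicalType) (f : T -> R) :
  continuous f -> continuous (fun x => (f x)%:C : C).
Proof. by move=> cf; apply: ccont_ReIm => //= x; exact: cvg_cst. Qed.

End ComplexModulus.

(** * Complex differentiability *)

Section Diff.
Context {R : realType}.
Local Notation C := (Cplx R).

(** The derivative with the quotient multiplied out: the case w = z is no exception, and estimates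
    can be added. *)
Definition cdiff (f : C -> C) (z d : C) :=
  forall e : R, 0 < e -> exists2 r : R, 0 < r &
    forall w, cmod (w - z) < r -> cmod (f w - f z - d * (w - z)) <= e * cmod (w - z).

Lemma is_derive_cdiff (f : C -> C) (z d : C) : is_derive z (1 : C) f d -> cdiff f z d.
Proof.
move=> [fl <-] e e0; set l := 'D_1 f z.
have /fl : nbhs l [set w | cmod (w - l) < e] by apply/cnbhsP; exists e.
rewrite /= /nbhs /= /dnbhs /within /= => /cnbhsP[r r0 H].
exists r => // w wz.
have [->|wNz] := eqVneq w z; first by rewrite !subrr mulr0 subr0 cmod0 mulr0.
have := H (w - z); rewrite subr0 => /(_ wz).
rewrite subr_eq0 => /(_ wNz).
rewrite [(w - z)%:A]mulr1 subrK => lt1.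
have -> : f w - f z - l * (w - z) = ((w - z)^-1 *: (f w - f z) - l) * (w - z).
  by rewrite mulrBl [_ *: _]mulrC divfK// subr_eq0.
by rewrite cmodM ler_wpM2r ?cmod_ge0// ltW.
Qed.

Lemma cdiff_is_derive (f : C -> C) (z d : C) : cdiff f z d -> is_derive z (1 : C) f d.
Proof.
move=> H.
have cl : (fun h => h^-1 *: ((f \o shift z) (h *: 1) - f z)) @ (0 : C)^' --> d.
  move=> A /cnbhsP[e e0 eA].
  have e2 : 0 < e / 2 by lra.
  have [r r0 Hr] := H _ e2.
  rewrite /= /nbhs /= /dnbhs /within /=; apply/cnbhsP; exists r => // w.
  rewrite subr0 => wr w0; apply: eA.
  have := Hr (w + z); rewrite addrK => /(_ wr).
  rewrite [w%:A]mulr1 => le1.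
  have -> : w^-1 *: (f (w + z) - f z) - d = w^-1 * (f (w + z) - f z - d * w).
    by rewrite mulrBr [_ *: _]/(_ * _) (mulrC d) mulKf.
  rewrite cmodM cmodV mulrC ltr_pdivrMr ?cmod_gt0//.
  apply: le_lt_trans le1 _; rewrite ltr_pM2r ?cmod_gt0//; lra.
apply: DeriveDef; first by apply/cvg_ex; exists d.
exact: (cvg_lim (@norm_hausdorff _ _) cl).
Qed.

Lemma cdiff_cont (f : C -> C) (z d : C) : cdiff f z d -> {for z, continuous f}.
Proof.
move=> H; apply/ccontP => e e0.
have [r r0 Hr] := H _ ltr01.
have K0 : 0 < 1 + cmod d by have := cmod_ge0 d; lra.
apply/cnbhsP; exists (Num.min r (e / (1 + cmod d))).
  by rewrite lt_min r0 divr_gt0.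
move=> w; rewrite lt_min ltr_pdivlMr// => /andP[/Hr w1 w2].
rewrite -(subrK (d * (w - z)) (f w - f z)).
apply: le_lt_trans (cmodD _ _) _; rewrite cmodM; nra.
Qed.

Lemma derivable_cdiff (f : C -> C) (z : C) :
  derivable f z 1 -> cdiff f z (derive1 f z).
Proof. by move=> df; apply: is_derive_cdiff; rewrite derive1E; apply: derivableP. Qed.

Lemma cdiff_derivable (f : C -> C) (z d : C) : cdiff f z d -> derivable f z 1.
Proof. by move=> /cdiff_is_derive []. Qed.

Lemma cdiff_derive1 (f : C -> C) (z d : C) : cdiff f z d -> derive1 f z = d.
Proof. by move=> /cdiff_is_derive [_ <-]; rewrite derive1E. Qed.

Lemma rderive_eps (f : R -> R) (x d : R) :
  (forall e, 0 < e -> exists2 r : R, 0 < r &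
     forall y, `|y - x| < r -> `|f y - f x - d * (y - x)| <= e * `|y - x|) ->
  is_derive x 1 f d.
Proof.
move=> H.
have cl : (fun h => h^-1 *: ((f \o shift x) (h *: 1) - f x)) @ 0^' --> d.
  apply/cvgrPdist_le => e e0; have [r r0 Hr] := H _ e0.
  rewrite near_withinE /=; apply/nbhs_ballP; exists r => //= h.
  rewrite -ball_normE /= sub0r normrN => hr h0.
  have := Hr (h + x); rewrite addrK => /(_ hr).
  rewrite [h%:A]mulr1 => le1.
  rewrite distrC -(ler_pM2r (x:=`|h|)) ?normr_gt0// -normrM mulrBl.
  by rewrite [_ *: _]mulrC divfK.
apply: DeriveDef; first by apply/cvg_ex; exists d.
exact: (cvg_lim (@norm_hausdorff _ _) cl).
Qed.

Lemma is_derive_line (f : C -> C) (p u d : C) (t : R) :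
  cdiff f (p + t%:C * u) d ->
  is_derive t 1 (fun s : R => Re (f (p + s%:C * u))) (Re (d * u)) /\
  is_derive t 1 (fun s : R => Im (f (p + s%:C * u))) (Im (d * u)).
Proof.
move=> H.
suff K e : 0 < e -> exists2 r : R, 0 < r & forall y, `|y - t| < r ->
    cmod (f (p + y%:C * u) - f (p + t%:C * u) - (y - t)%:C * (d * u)) <= e * `|y - t|.
  split; apply: rderive_eps => e /K[r r0 Hr]; exists r => // y /Hr; apply: le_trans.
  - apply: le_trans (Re_le_cmod _); rewrite !ReImE /=.
    by rewrite mul0r subr0 (mulrC (y - t)).
  - apply: le_trans (Im_le_cmod _); rewrite !ReImE /=.
    by rewrite mul0r addr0 (mulrC (y - t)).
move=> e0; pose K := cmod u + 1.
have K0 : 0 < K by rewrite /K; have := cmod_ge0 u; lra.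
have [r r0 Hr] := H _ (divr_gt0 e0 K0).
exists (r / K); first exact: divr_gt0.
move=> y; rewrite ltr_pdivlMr// => yt.
have E : p + y%:C * u - (p + t%:C * u) = (y - t)%:C * u by rewrite rmorphB /=; ring.
have := Hr (p + y%:C * u); rewrite E cmodM cmod_real.
have uK : cmod u <= K by rewrite /K; lra.
have n0 := normr_ge0 (y - t).
have yu : `|y - t| * cmod u <= `|y - t| * K by exact: ler_wpM2l.
move=> /(_ (le_lt_trans yu yt)).
rewrite mulrCA; move/le_trans; apply.
by rewrite -mulrA ler_pM2l// mulrC ler_pdivrMr.
Qed.

(* A complex-valued mean value inequality, obtained on the real and imaginary
   parts separately: hence the factor 2. *)
Lemma mean_value_le (f f' : C -> C) (p q : C) (K : R) :
  (forall t : R, 0 <= t <= 1 -> cdiff f (p + t%:C * (q - p)) (f' (p + t%:C * (q - p)))) ->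
  (forall t : R, 0 <= t <= 1 -> cmod (f' (p + t%:C * (q - p))) <= K) ->
  cmod (f q - f p) <= 2 * (K * cmod (q - p)).
Proof.
move=> df bf; set u := q - p.
have E0 : p + 0%:C * u = p by rewrite mul0r addr0.
have E1 : p + 1%:C * u = q by rewrite mul1r /u addrC subrK.
have bnd c : 0 <= c <= 1 -> cmod (f' (p + c%:C * u) * u) <= K * cmod u.
  by move=> c01; rewrite cmodM ler_wpM2r ?cmod_ge0// bf.
suff [r1 r2] : `|Re (f q - f p)| <= K * cmod u /\ `|Im (f q - f p)| <= K * cmod u.
  by apply: le_trans (cmod_le_ReIm _) _; lra.
have d01 x : x \in `]0, 1[%R -> 0 <= x <= 1.
  by rewrite in_itv /= => /andP[/ltW -> /ltW ->].
split.
- have [||c] := @MVT _ (fun s => Re (f (p + s%:C * u)))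
    (fun s => Re (f' (p + s%:C * u) * u)) 0 1 ltr01.
  + by move=> x /d01/df/is_derive_line[].
  + apply: derivable_within_continuous => x; rewrite in_itv /= => /df.
    by move=> /is_derive_line[[]].
  rewrite E0 E1 subr0 mulr1 => /d01 c01; rewrite !ReImE => ->.
  by apply: le_trans (bnd _ c01); rewrite -!ReImE Re_le_cmod.
- have [||c] := @MVT _ (fun s => Im (f (p + s%:C * u)))
    (fun s => Im (f' (p + s%:C * u) * u)) 0 1 ltr01.
  + by move=> x /d01/df/is_derive_line[].
  + apply: derivable_within_continuous => x; rewrite in_itv /= => /df.
    by move=> /is_derive_line[_ []].
  rewrite E0 E1 subr0 mulr1 => /d01 c01; rewrite !ReImE => ->.
  by apply: le_trans (bnd _ c01); rewrite -!ReImE Im_le_cmod.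
Qed.

End Diff.

(** * Integrals of continuous functions as increments of primitives *)

Section Integral.
Context {R : realType}.
Local Notation C := (Cplx R).
Implicit Types phi psi : R -> R.

Definition primitive phi (P : R -> R) := forall x, is_derive x (1 : R) P (phi x).

(** Stated on an open interval because the functions glued in [primitive_exists] are primitives only
    there. *)
Lemma primitive_itv_unique phi (a b : R) (F G : R -> R) :
  (forall x, a < x < b -> is_derive x (1 : R) F (phi x)) ->
  (forall x, a < x < b -> is_derive x (1 : R) G (phi x)) ->
  forall x y, a < x < b -> a < y < b -> F y - F x = G y - G x.
Proof.
move=> dF dG.
suff le x y : x <= y -> a < x < b -> a < y < b -> F y - F x = G y - G x.
  move=> x y xab yab; have [xy|/ltW yx] := leP x y; first exact: le.
  by have := le _ _ yx yab xab; lra.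
move=> xy /andP[ax xb] /andP[ay yb].
have sub t : t \in `[x, y]%R -> a < t < b.
  rewrite in_itv /= => /andP[xt ty].
  by rewrite (lt_le_trans ax xt) (le_lt_trans ty yb).
have dFG t : a < t < b -> is_derive t (1 : R) (F - G) 0.
  move=> tab; have := dF _ tab; have := dG _ tab => {}dGt {}dFt.
  by apply: is_derive_eq; rewrite subrr.
have [| |c _] := @MVT_segment _ (F - G) (fun=> 0) x y xy.
- move=> t txy; apply/dFG/sub; move: txy; rewrite !in_itv /= => /andP[/ltW-> /ltW->//].
- by apply: derivable_within_continuous => t /sub/dFG[].
have fgE t : (F - G) t = F t - G t by [].
by rewrite mul0r !fgE; lra.
Qed.

(** The integral from -n is a primitive on ]-n, n[. Normalised to vanish at 0, these primitives
    agree on overlaps and glue to one on the line. *)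
Lemma primitive_exists phi : continuous phi -> exists P, primitive phi P.
Proof.
move=> cphi.
pose F (n : nat) (x : R) : R := (\int[lebesgue_measure]_(t in `[- n%:R, x]) phi t)%R.
have dF n (x : R) : - n%:R < x < n%:R -> is_derive x (1 : R) (F n) (phi x).
  move=> /andP[nx xn].
  have [|dd <-] := @continuous_FTC1_closed R phi (- n%:R) x n%:R xn _ nx (cphi x).
    apply: continuous_compact_integrable; first exact: segment_compact.
    exact: continuous_subspaceT.
  apply: DeriveDef; first exact: dd.
  by rewrite derive1E.
pose n (x : R) := (Num.truncn `|x|).+1.
have nP (x : R) : - (n x)%:R < x < (n x)%:R.
  by rewrite -ltr_norml /n truncnS_gt.
have gt0 (x : R) : - (n x)%:R < (0 : R) < (n x)%:R by rewrite oppr_lt0 ltr0n.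
exists (fun x => F (n x) x - F (n x) 0) => x.
have E (y : R) : - (n x)%:R < y < (n x)%:R -> F (n y) y - F (n y) 0 = F (n x) y - F (n x) 0.
  move=> yx; have [nxy|/ltW nyx] := leP (n x) (n y).
  - apply: (@primitive_itv_unique phi (- (n x)%:R) (n x)%:R (F (n y)) (F (n x)) _ (dF (n x))
      0 y (gt0 _) yx).
    move=> t /andP[t1 t2].
    apply: dF; rewrite (lt_le_trans t2) ?ler_nat// andbT.
    by apply: le_lt_trans t1; rewrite lerN2 ler_nat.
  - apply: (@primitive_itv_unique phi (- (n y)%:R) (n y)%:R (F (n y)) (F (n x)) (dF (n y)) _
      0 y (gt0 y) (nP y)).
    move=> t /andP[t1 t2].
    apply: dF; rewrite (lt_le_trans t2) ?ler_nat// andbT.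
    by apply: le_lt_trans t1; rewrite lerN2 ler_nat.
have dG : is_derive x (1 : R) (fun y => F (n x) y - F (n x) 0) (phi x).
  have dd := dF _ _ (nP x).
  by have := is_deriveB dd (is_derive_cst (F (n x) 0) x (1 : R)); rewrite subr0.
apply: near_eq_is_derive dG.
near=> y; apply/esym/E.
near: y; have [x1 x2] := andP (nP x).
by near=> y; apply/andP; split; near: y; [exact: lt_nbhsr|exact: lt_nbhsl].
Unshelve. all: by end_near. Qed.

(* A junk value when [phi] has no primitive. *)
Definition prim phi : R -> R := xget (fun=> 0) [set P | primitive phi P].

(** With this encoding Chasles' relation is algebra; the price is that integrands must be continuous
    on the whole line. *)
Definition rint phi a b : R := prim phi b - prim phi a.

Lemma primP phi : continuous phi -> primitive phi (prim phi).
Proof. by move=> /primitive_exists; exact: (@xgetPex _ (fun=> 0) [set P | primitive phi P]). Qed.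

Lemma rint_FTC phi (P : R -> R) a b : primitive phi P -> rint phi a b = P b - P a.
Proof.
move=> pP; have pp : primitive phi (prim phi).
  by apply: (@xgetPex _ (fun=> 0) [set P | primitive phi P]); exists P.
pose M := Num.max `|a| `|b| + 1.
have [aM bM] : - M < a < M /\ - M < b < M.
  rewrite -!ltr_norml /M; split; apply: le_lt_trans (ltr_pwDr ltr01 (lexx _));
  by rewrite le_max lexx ?orbT.
by apply: (@primitive_itv_unique phi (-M) M) => // x _.
Qed.

Lemma rintD phi psi a b : continuous phi -> continuous psi ->
  rint (fun x => phi x + psi x) a b = rint phi a b + rint psi a b.
Proof.
move=> /primP p1 /primP p2.
rewrite (@rint_FTC _ (prim phi + prim psi)).
  have E t : (prim phi + prim psi) t = prim phi t + prim psi t by [].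
  by rewrite /rint !E; lra.
by move=> x; have := p1 x; have := p2 x => d2 d1; apply: is_deriveD.
Qed.

Lemma rintZ (c : R) phi a b : continuous phi ->
  rint (fun x => c * phi x) a b = c * rint phi a b.
Proof.
move=> /primP p1.
rewrite (@rint_FTC _ (c *: prim phi)).
  have E t : (c *: prim phi) t = c * prim phi t by [].
  by rewrite /rint !E; lra.
by move=> x; have := p1 x => d1; apply: is_deriveZ.
Qed.

Lemma rint_chasles phi a b c : rint phi a b + rint phi b c = rint phi a c.
Proof. by rewrite /rint; lra. Qed.

(** Takes the place of monotonicity: the bounds on integrals are derived from it. *)
Lemma rint_MVT phi a b : continuous phi -> a <= b ->
  exists2 c, a <= c <= b & rint phi a b = phi c * (b - a).
Proof.
move=> /primP p1 ab.
have [| |c + E] := @MVT_segment _ (prim phi) phi a b ab.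
- by move=> x _.
- by apply: derivable_within_continuous => x _; have [] := p1 x.
by rewrite in_itv /= => cab; exists c.
Qed.

Implicit Types f g : R -> C.

Definition cint f a b : C :=
  (rint (fun x => Re (f x)) a b)%:C + 'i * (rint (fun x => Im (f x)) a b)%:C.

Lemma Re_cont f : continuous f -> continuous (fun x => Re (f x)).
Proof. by move=> cf x; apply: continuous_comp; [exact: cf|exact: Re_continuous]. Qed.

Lemma Im_cont f : continuous f -> continuous (fun x => Im (f x)).
Proof. by move=> cf x; apply: continuous_comp; [exact: cf|exact: Im_continuous]. Qed.

Lemma cintD f g a b : continuous f -> continuous g ->
  cint (fun x => f x + g x) a b = cint f a b + cint g a b.
Proof.
move=> cf cg; rewrite /cint.
have -> : (fun x => Re (f x + g x)) = (fun x => Re (f x) + Re (g x)).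
  by apply/funext => x; rewrite ReD.
have -> : (fun x => Im (f x + g x)) = (fun x => Im (f x) + Im (g x)).
  by apply/funext => x; rewrite ImD.
rewrite !rintD; try (exact: Re_cont || exact: Im_cont).
by rewrite !rmorphD /=; ring.
Qed.

Lemma cintM (c : C) f a b : continuous f ->
  cint (fun x => c * f x) a b = c * cint f a b.
Proof.
move=> cf; rewrite /cint.
have -> : (fun x => Re (c * f x)) = (fun x => Re c * Re (f x) + (- Im c) * Im (f x)).
  by apply/funext => x; rewrite ReM mulNr.
have -> : (fun x => Im (c * f x)) = (fun x => Re c * Im (f x) + Im c * Re (f x)).
  by apply/funext => x; rewrite ImM.
have cr := Re_cont cf; have ci := Im_cont cf.
have cZ (r : R) (p : R -> R) : continuous p -> continuous (fun x => r * p x).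
  by move=> cp x; apply: cvgM; [exact: cvg_cst|exact: cp].
rewrite !rintD ?rintZ//; try exact: cZ.
by rewrite [in RHS](complexReIm c); apply: complex_eqP; rewrite !ReImE /=; ring.
Qed.

Lemma cint_chasles f a b c : cint f a b + cint f b c = cint f a c.
Proof.
rewrite /cint -(rint_chasles _ a b c) -(rint_chasles (fun x => Im _) a b c).
by rewrite !rmorphD /=; ring.
Qed.

(** The mean value theorem applies to the real and imaginary parts separately, at two different
    points: hence the factor 2. *)
Lemma cint_le f a b (K : R) : continuous f -> a <= b ->
  (forall x, a <= x <= b -> cmod (f x) <= K) ->
  cmod (cint f a b) <= 2 * (K * (b - a)).
Proof.
move=> cf ab fK.
have [c /fK cab Ec] := rint_MVT (Re_cont cf) ab.
have [d /fK dab Ed] := rint_MVT (Im_cont cf) ab.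
rewrite /cint; apply: le_trans (cmodD _ _) _.
have ba0 : 0 <= b - a by lra.
rewrite cmodM cmodi mul1r !cmod_real Ec Ed !normrM !(ger0_norm ba0).
have h1 : `|Re (f c)| * (b - a) <= K * (b - a).
  by apply: ler_wpM2r => //; apply: le_trans cab; exact: Re_le_cmod.
have h2 : `|Im (f d)| * (b - a) <= K * (b - a).
  by apply: ler_wpM2r => //; apply: le_trans dab; exact: Im_le_cmod.
by lra.
Qed.

Lemma Im_cint f a b : Im (cint f a b) = rint (fun x => Im (f x)) a b.
Proof. by rewrite /cint !ReImE /=; ring. Qed.

Lemma cint_FTC (g g' : C -> C) (p u : C) a b :
  (forall t : R, cdiff g (p + t%:C * u) (g' (p + t%:C * u))) ->
  cint (fun t => g' (p + t%:C * u) * u) a b = g (p + b%:C * u) - g (p + a%:C * u).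
Proof.
move=> dg; rewrite /cint.
rewrite (@rint_FTC _ (fun s => Re (g (p + s%:C * u)))); last first.
  by move=> t; have [] := is_derive_line (dg t).
rewrite (@rint_FTC _ (fun s => Im (g (p + s%:C * u)))); last first.
  by move=> t; have [] := is_derive_line (dg t).
by apply: complex_eqP; rewrite !ReImE /=; ring.
Qed.

End Integral.

Section Bisection.
Context {R : realType}.
Implicit Types (T : R -> R -> R -> R -> Prop).

Lemma half_pow_small (w e : R) : 0 < e -> exists n, w / 2 ^+ n < e.
Proof.
pose n := (Num.truncn (w / e)).+1; move=> e0; exists n.
have h : w / e < n%:R by rewrite /n truncnS_gt.
rewrite ltr_pdivrMr ?exprn_gt0// mulrC -ltr_pdivrMr//.
apply: lt_le_trans h _; rewrite -natrX ler_nat.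
exact/ltnW/ltn_expl.
Qed.

(** Every left end is below every right end, so the supremum of the left ends lies in all the
    intervals. *)
Lemma nested_intervals (x : nat -> R) (w : R) : 0 <= w ->
  (forall n, x n <= x n.+1 <= x n + w / 2 ^+ n.+1) ->
  exists p, forall n, x n <= p <= x n + w / 2 ^+ n.
Proof.
move=> w0 xS.
have w2 n : w / 2 ^+ n = w / 2 ^+ n.+1 + w / 2 ^+ n.+1.
  by rewrite exprS invfM; field; rewrite expf_neq0.
have nd n k : x n <= x (n + k)%N /\
    x (n + k)%N + w / 2 ^+ (n + k) <= x n + w / 2 ^+ n.
  elim: k => [|k [IH1 IH2]]; first by rewrite addn0.
  have /andP[h1 h2] := xS (n + k)%N; have h3 := w2 (n + k)%N.
  by rewrite addnS; split; lra.
have w2_ge0 n : 0 <= w / 2 ^+ n by rewrite divr_ge0// exprn_ge0.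
have ub n m : x m <= x n + w / 2 ^+ n.
  have [/subnKC <-|/ltnW/subnKC <-] := leqP n m.
  - by have [_] := nd n (m - n)%N; have := w2_ge0 (n + (m - n))%N; lra.
  - by have [+ _] := nd m (n - m)%N; have := w2_ge0 (m + (n - m))%N; lra.
have hs : has_sup (range x).
  by split; [exists (x 0%N), 0%N|exists (x 0%N + w / 2 ^+ 0) => _ [m _ <-]].
exists (sup (range x)) => n; apply/andP; split.
- by apply: ub_le_sup; [exact: hs.2|exists n].
- by apply: ge_sup; [exact: hs.1|move=> _ [m _ <-]].
Qed.

(* [T x y w h] is a property of the rectangle [x, x + w] * [y, y + h]. *)
Lemma bisection T (x0 y0 w0 h0 : R) : 0 < w0 -> 0 < h0 ->
  (forall x y w h, 0 < w -> 0 < h ->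
     T x y (w / 2) (h / 2) -> T (x + w / 2) y (w / 2) (h / 2) ->
     T x (y + h / 2) (w / 2) (h / 2) -> T (x + w / 2) (y + h / 2) (w / 2) (h / 2) ->
     T x y w h) ->
  (forall p q, x0 <= p <= x0 + w0 -> y0 <= q <= y0 + h0 ->
     exists2 e : R, 0 < e & forall x y w h,
       x <= p <= x + w -> y <= q <= y + h -> 0 < w < e -> 0 < h < e ->
       x0 <= x -> x + w <= x0 + w0 -> y0 <= y -> y + h <= y0 + h0 ->
       T x y w h) ->
  T x0 y0 w0 h0.
Proof.
move=> w00 h00 quarter local; apply: contrapT => NT.
pose W n := w0 / 2 ^+ n; pose H n := h0 / 2 ^+ n.
have WS n : W n.+1 = W n / 2 by rewrite /W exprSr invfM mulrA.
have HS n : H n.+1 = H n / 2 by rewrite /H exprSr invfM mulrA.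
have W0 n : 0 < W n by rewrite divr_gt0// exprn_gt0.
have H0 n : 0 < H n by rewrite divr_gt0// exprn_gt0.
(* Moves to a quarter where [T] fails. The last quarter is the default, justified by [quarter] once
   [T] holds on the other three. *)
pose step n (z : R * R) : R * R :=
  let w := W n.+1 in let h := H n.+1 in
  if `[< ~ T z.1 z.2 w h >] then z
  else if `[< ~ T (z.1 + w) z.2 w h >] then (z.1 + w, z.2)
  else if `[< ~ T z.1 (z.2 + h) w h >] then (z.1, z.2 + h)
  else (z.1 + w, z.2 + h).
pose fix s n : R * R := if n is m.+1 then step m (s m) else (x0, y0).
have sNT n : ~ T (s n).1 (s n).2 (W n) (H n).
  elim: n => [|n IH]; first by rewrite /W /H /= !divr1.
  rewrite /= /step; case: asboolP => //= /contrapT t1.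
  case: asboolP => //= /contrapT t2; case: asboolP => //= /contrapT t3 t4.
  by apply: IH; move: t1 t2 t3 t4; rewrite WS HS; exact: quarter.
have sx n : (s n).1 <= (s n.+1).1 <= (s n).1 + W n.+1.
  have := W0 n.+1; rewrite /= /step => w1.
  by do 3?[case: ifP => _ /=]; lra.
have sy n : (s n).2 <= (s n.+1).2 <= (s n).2 + H n.+1.
  have := H0 n.+1; rewrite /= /step => w1.
  by do 3?[case: ifP => _ /=]; lra.
have [p Hp] := nested_intervals (ltW w00) sx.
have [q Hq] := nested_intervals (ltW h00) sy.
have inx n : x0 <= (s n).1 /\ (s n).1 + W n <= x0 + w0.
  elim: n => [|n [i1 i2]]; first by rewrite /= /W divr1.
  have /andP[] := sx n; have := WS n; lra.
have iny n : y0 <= (s n).2 /\ (s n).2 + H n <= y0 + h0.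
  elim: n => [|n [i1 i2]]; first by rewrite /= /H divr1.
  have /andP[] := sy n; have := HS n; lra.
have [||e e0 He] := local p q.
- by have := Hp 0%N; rewrite /= divr1.
- by have := Hq 0%N; rewrite /= divr1.
have [n1 Hn1] := half_pow_small w0 e0; have [n2 Hn2] := half_pow_small h0 e0.
pose n := maxn n1 n2.
have mono (a : R) m : 0 < a -> (m <= n)%N -> a / 2 ^+ n <= a / 2 ^+ m.
  move=> a0 mn; rewrite ler_pM2l// lef_pV2 ?posrE ?exprn_gt0//.
  by rewrite ler_eXn2l ?ltr1n.
apply: (sNT n); apply: He.
- exact: Hp.
- exact: Hq.
- by rewrite W0 /=; apply: le_lt_trans Hn1; apply: mono => //; exact: leq_maxl.
- by rewrite H0 /=; apply: le_lt_trans Hn2; apply: mono => //; exact: leq_maxr.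
- by have [] := inx n.
- by have [] := inx n.
- by have [] := iny n.
- by have [] := iny n.
Qed.

End Bisection.

(** * Contour integrals over rectangles *)

Section Contour.
Context {R : realType}.
Local Notation C := (Cplx R).
Implicit Types (h g : C -> C) (p u : C).

Definition seg h p u (a b : R) : C := cint (fun t => h (p + t%:C * u) * u) a b.

Definition segcont h p u := continuous (fun t : R => h (p + t%:C * u)).

Lemma segcont_mulr h p u : segcont h p u ->
  continuous (fun t : R => h (p + t%:C * u) * u).
Proof. by move=> hc; exact: (ccontM hc (@ccont_cst _ _ _)). Qed.

Lemma segD h g p u a b : segcont h p u -> segcont g p u ->
  seg (fun z => h z + g z) p u a b = seg h p u a b + seg g p u a b.
Proof.
move=> hc gc; rewrite /seg -(cintD _ _ (segcont_mulr hc) (segcont_mulr gc)).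
by congr cint; apply/funext => t; rewrite mulrDl.
Qed.

Lemma segM (c : C) h p u a b : segcont h p u ->
  seg (fun z => c * h z) p u a b = c * seg h p u a b.
Proof.
move=> hc; rewrite /seg -cintM; last exact: segcont_mulr.
by congr cint; apply/funext => t; rewrite mulrA.
Qed.

Lemma seg_chasles h p u a b c : seg h p u a b + seg h p u b c = seg h p u a c.
Proof. exact: cint_chasles. Qed.

Lemma seg_le h p u a b (K : R) : segcont h p u -> cmod u = 1 -> a <= b ->
  (forall t : R, a <= t <= b -> cmod (h (p + t%:C * u)) <= K) ->
  cmod (seg h p u a b) <= 2 * (K * (b - a)).
Proof.
move=> hc u1 ab hK; apply: (cint_le (segcont_mulr hc) ab) => t /hK.
by rewrite cmodM u1 mulr1.
Qed.

Definition hline (y : R) : C := 'i * y%:C.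
Definition vline (x : R) : C := x%:C.

Definition contour h (x0 x1 y0 y1 : R) : C :=
  seg h (hline y0) 1 x0 x1 - seg h (hline y1) 1 x0 x1
  + (seg h (vline x1) 'i y0 y1 - seg h (vline x0) 'i y0 y1).

Definition contour_cont h (x0 x1 y0 y1 : R) :=
  [/\ segcont h (hline y0) 1, segcont h (hline y1) 1,
      segcont h (vline x1) 'i & segcont h (vline x0) 'i].

(** The full lines that carry the sides, since integrands have to be continuous along whole
    lines. *)
Definition on_lines (x0 x1 y0 y1 : R) (z : C) : Prop :=
  [\/ Re z = x0, Re z = x1, Im z = y0 | Im z = y1].

Definition rect (x0 x1 y0 y1 : R) : set C :=
  [set z | x0 <= Re z <= x1 /\ y0 <= Im z <= y1].

Lemma hlineE (y t : R) : Re (hline y + t%:C * 1) = t /\ Im (hline y + t%:C * 1) = y.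
Proof. by rewrite /hline !ReImE /=; split; ring. Qed.

Lemma vlineE (x t : R) : Re (vline x + t%:C * 'i) = x /\ Im (vline x + t%:C * 'i) = t.
Proof. by rewrite /vline !ReImE /=; split; ring. Qed.

Lemma contour_contP h x0 x1 y0 y1 :
  (forall z, on_lines x0 x1 y0 y1 z -> {for z, continuous h}) ->
  contour_cont h x0 x1 y0 y1.
Proof.
move=> hc.
have lc p u : continuous (fun t : R => p + t%:C * u : C).
  apply: ccontD; first exact: ccont_cst.
  by apply: ccontM; [apply: ccont_real => ?; exact: cvg_id|exact: ccont_cst].
split=> t; apply: continuous_comp; try exact: lc; apply: hc.
- by constructor 3; have [] := hlineE y0 t.
- by constructor 4; have [] := hlineE y1 t.
- by constructor 2; have [] := vlineE x1 t.
- by constructor 1; have [] := vlineE x0 t.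
Qed.

Lemma contour_cont_total h x0 x1 y0 y1 : continuous h -> contour_cont h x0 x1 y0 y1.
Proof. by move=> hc; apply: contour_contP => z _; exact: hc. Qed.

Section FixedRectangle.
Variables (x0 x1 y0 y1 : R).
Hypotheses (x01 : x0 <= x1) (y01 : y0 <= y1).
Local Notation cc h := (contour_cont h x0 x1 y0 y1).
Local Notation ct h := (contour h x0 x1 y0 y1).

Lemma contour_contD h g : cc h -> cc g -> cc (fun z => h z + g z).
Proof.
move=> [h1 h2 h3 h4] [g1 g2 g3 g4].
by split; [exact: ccontD h1 g1|exact: ccontD h2 g2|exact: ccontD h3 g3|exact: ccontD h4 g4].
Qed.

Lemma contour_contM h g : cc h -> cc g -> cc (fun z => h z * g z).
Proof.
move=> [h1 h2 h3 h4] [g1 g2 g3 g4].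
by split; [exact: ccontM h1 g1|exact: ccontM h2 g2|exact: ccontM h3 g3|exact: ccontM h4 g4].
Qed.

Lemma contour_cont_cst (c : C) : cc (fun=> c).
Proof. by split; exact: ccont_cst. Qed.

Lemma contourD h g : cc h -> cc g -> ct (fun z => h z + g z) = ct h + ct g.
Proof.
move=> [h1 h2 h3 h4] [g1 g2 g3 g4]; rewrite /contour.
by rewrite (segD _ _ h1 g1) (segD _ _ h2 g2) (segD _ _ h3 g3) (segD _ _ h4 g4); ring.
Qed.

Lemma contourM (c : C) h : cc h -> ct (fun z => c * h z) = c * ct h.
Proof.
move=> [h1 h2 h3 h4]; rewrite /contour.
by rewrite (segM _ _ _ h1) (segM _ _ _ h2) (segM _ _ _ h3) (segM _ _ _ h4); ring.
Qed.

Lemma contour_le h (K : R) : cc h ->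
  (forall z, rect x0 x1 y0 y1 z -> on_lines x0 x1 y0 y1 z -> cmod (h z) <= K) ->
  cmod (ct h) <= 4 * (K * ((x1 - x0) + (y1 - y0))).
Proof.
move=> [c1 c2 c3 c4] hK.
have b1 : cmod (seg h (hline y0) 1 x0 x1) <= 2 * (K * (x1 - x0)).
  apply: (seg_le c1 (@cmod1 R) x01).
  move=> t t01; have [rz iz] := hlineE y0 t; apply: hK; last by constructor 3.
  by split; rewrite ?rz ?iz ?t01 ?lexx ?y01.
have b2 : cmod (seg h (hline y1) 1 x0 x1) <= 2 * (K * (x1 - x0)).
  apply: (seg_le c2 (@cmod1 R) x01).
  move=> t t01; have [rz iz] := hlineE y1 t; apply: hK; last by constructor 4.
  by split; rewrite ?rz ?iz ?t01 ?lexx ?andbT.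
have b3 : cmod (seg h (vline x1) 'i y0 y1) <= 2 * (K * (y1 - y0)).
  apply: (seg_le c3 (@cmodi R) y01).
  move=> t t01; have [rz iz] := vlineE x1 t; apply: hK; last by constructor 2.
  by split; rewrite ?rz ?iz ?t01 ?lexx ?andbT.
have b4 : cmod (seg h (vline x0) 'i y0 y1) <= 2 * (K * (y1 - y0)).
  apply: (seg_le c4 (@cmodi R) y01).
  move=> t t01; have [rz iz] := vlineE x0 t; apply: hK; last by constructor 1.
  by split; rewrite ?rz ?iz ?t01 ?lexx ?y01.
rewrite /contour; apply: le_trans (cmodD _ _) _.
have := cmodB (seg h (hline y0) 1 x0 x1) (seg h (hline y1) 1 x0 x1).
have := cmodB (seg h (vline x1) 'i y0 y1) (seg h (vline x0) 'i y0 y1).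
lra.
Qed.

(** The primitives chosen for [h] and [g] also depend on values off the sides; the integral of the
    difference is bounded by 0 through [contour_le], which only looks at the sides. *)
Lemma contour_eq h g : cc h -> cc g ->
  (forall z, rect x0 x1 y0 y1 z -> on_lines x0 x1 y0 y1 z -> h z = g z) ->
  ct h = ct g.
Proof.
move=> hc gc hg; apply/eqP; rewrite -subr_eq0 -cmod_eq0.
have gNc : cc (fun z => -1 * g z) by exact: (contour_contM (contour_cont_cst _) gc).
rewrite -mulN1r -contourM; last exact: gc.
rewrite -(contourD hc gNc) eq_le cmod_ge0 andbT.
apply: le_trans (@contour_le _ 0 (contour_contD hc gNc) _) _.
- by move=> z rz lz; rewrite hg// mulN1r subrr cmod0.
- by rewrite mul0r mulr0.
Qed.

Lemma contour_FTC g (g' : C -> C) :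
  (forall z, on_lines x0 x1 y0 y1 z -> cdiff g z (g' z)) -> ct g' = 0.
Proof.
move=> dg; rewrite /contour /seg.
rewrite (@cint_FTC _ g g'); last by move=> t; apply: dg; constructor 3; have [] := hlineE y0 t.
rewrite (@cint_FTC _ g g'); last by move=> t; apply: dg; constructor 4; have [] := hlineE y1 t.
rewrite (@cint_FTC _ g g'); last by move=> t; apply: dg; constructor 2; have [] := vlineE x1 t.
rewrite (@cint_FTC _ g g'); last by move=> t; apply: dg; constructor 1; have [] := vlineE x0 t.
have E x y : vline x + y%:C * 'i = hline y + x%:C * 1 by rewrite /hline /vline; ring.
by rewrite !E; ring.
Qed.

End FixedRectangle.

Lemma contour_hsplit h x0 x1 y0 y1 xm :
  contour h x0 x1 y0 y1 = contour h x0 xm y0 y1 + contour h xm x1 y0 y1.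
Proof.
rewrite /contour -(seg_chasles h _ _ x0 xm x1) -(seg_chasles h (hline y1) _ x0 xm x1).
by ring.
Qed.

Lemma contour_vsplit h x0 x1 y0 y1 ym :
  contour h x0 x1 y0 y1 = contour h x0 x1 y0 ym + contour h x0 x1 ym y1.
Proof.
rewrite /contour -(seg_chasles h (vline x1) _ y0 ym y1).
by rewrite -(seg_chasles h (vline x0) _ y0 ym y1); ring.
Qed.

End Contour.

Section Goursat.
Context {R : realType}.
Local Notation C := (Cplx R).

(** The value 1/2 at [c] lets a nondegenerate interval that only has [c] as an end still pick up
    half of the unit jump. A rectangle containing [p], even at a corner, thus has mass at least
    1/4. *)
Definition jump (c t : R) : R := if t < c then 0 else if t == c then 1 / 2 else 1.

Lemma jump_homo (c s t : R) : s <= t -> jump c s <= jump c t.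
Proof. move=> ?; rewrite /jump; case: ltgtP => sc; case: ltgtP => tc; lra. Qed.

Lemma jump_half (c s t : R) : s <= c <= t -> s < t -> 1 / 2 <= jump c t - jump c s.
Proof. move=> /andP[? ?] ?; rewrite /jump; case: ltgtP => sc; case: ltgtP => tc; lra. Qed.

Lemma cdiff_affine_primitive (a d p z : C) :
  cdiff (fun w => a * w + d / 2%:R * (w - p) ^+ 2) z (a + d * (z - p)).
Proof.
move=> e e0; have K0 : 0 < cmod d + 1 by have := cmod_ge0 d; lra.
exists (e / (cmod d + 1)); first exact: divr_gt0.
move=> w; rewrite ltr_pdivlMr// => wz.
have -> : a * w + d / 2%:R * (w - p) ^+ 2 - (a * z + d / 2%:R * (z - p) ^+ 2)
    - (a + d * (z - p)) * (w - z) = d / 2%:R * (w - z) * (w - z) by field.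
rewrite !cmodM cmodV cmod_nat; apply: ler_wpM2r; first exact: cmod_ge0.
have := cmod_ge0 (w - z); have := cmod_ge0 d; nra.
Qed.

(* The exceptional point [p] is handled by adding to the comparison function
   (w + h)^2 of the bisection a finitely additive point mass at [p], each
   corner sharing an equal part of it. *)
Lemma goursat (h : C -> C) (x0 y0 w0 h0 : R) (p : C) :
  0 < w0 -> 0 < h0 -> continuous h ->
  (forall z, rect x0 (x0 + w0) y0 (y0 + h0) z -> z != p -> exists d : C,
    forall e : R, 0 < e -> exists2 r : R, 0 < r & forall w,
      rect x0 (x0 + w0) y0 (y0 + h0) w -> cmod (w - z) < r ->
      cmod (h w - h z - d * (w - z)) <= e * cmod (w - z)) ->
  contour h x0 (x0 + w0) y0 (y0 + h0) = 0.
Proof.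
move=> w00 h00 hc hd.
pose nu (x x' y y' : R) := (jump (Re p) x' - jump (Re p) x) * (jump (Im p) y' - jump (Im p) y).
have nu_ge0 x x' y y' : x <= x' -> y <= y' -> 0 <= nu x x' y y'.
  by move=> xx yy; apply: mulr_ge0; rewrite subr_ge0; exact: jump_homo.
have cch x x' y y' : contour_cont h x x' y y' by exact: contour_cont_total.
suff main e : 0 < e -> cmod (contour h x0 (x0 + w0) y0 (y0 + h0)) <=
    e * ((w0 + h0) ^+ 2 + nu x0 (x0 + w0) y0 (y0 + h0)).
  apply/eqP; rewrite -cmod_eq0 eq_le cmod_ge0 andbT.
  apply/ler_addgt0Pl => e e0; rewrite addr0.
  set K := (w0 + h0) ^+ 2 + nu x0 (x0 + w0) y0 (y0 + h0).
  have K0 : 0 < K by rewrite ltr_wpDr ?nu_ge0 ?exprn_gt0; lra.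
  have := main (e / K) (divr_gt0 e0 K0).
  by rewrite -/K divfK// gt_eqF.
move=> e0.
apply: (@bisection R (fun x y w v => cmod (contour h x (x + w) y (y + v)) <=
  e * ((w + v) ^+ 2 + nu x (x + w) y (y + v)))) => //.
  move=> x y w v w_gt0 v_gt0.
  have -> : x + w / 2 + w / 2 = x + w by lra.
  have -> : y + v / 2 + v / 2 = y + v by lra.
  rewrite (contour_hsplit h x (x + w) y (y + v) (x + w / 2)).
  rewrite (contour_vsplit h x (x + w / 2) y (y + v) (y + v / 2)).
  rewrite (contour_vsplit h (x + w / 2) (x + w) y (y + v) (y + v / 2)).
  move: (contour _ _ _ _ _) (contour _ _ _ _ _) (contour _ _ _ _ _) (contour _ _ _ _ _) => A B D E'.
  move=> TA TD TB TE.
  apply: le_trans (cmodD _ _) _.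
  apply: le_trans (lerD (cmodD _ _) (cmodD _ _)) _.
  apply: le_trans (lerD (lerD TA TB) (lerD TD TE)) _.
  by rewrite le_eqVlt /nu; apply/orP; left; apply/eqP; field.
move=> pa pb paI pbI.
have [z [rez imz]] : exists z : C, Re z = pa /\ Im z = pb.
  by exists (pa%:C + 'i * pb%:C); rewrite !ReImE /=; split; ring.
have near_z x y w v r zeta : x <= pa <= x + w -> y <= pb <= y + v -> w + v < r ->
    rect x (x + w) y (y + v) zeta -> cmod (zeta - z) <= w + v /\ cmod (zeta - z) < r.
  move=> xpa ypb wvr [r1 r2].
  suff le1 : cmod (zeta - z) <= w + v by split => //; lra.
  apply: le_trans (cmod_le_ReIm _) _; rewrite !ReImE rez imz.
  by apply: lerD; rewrite ler_norml; lra.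
have [zp|zNp] := eqVneq z p.
  have := hc z => /ccontP/(_ _ ltr01)/cnbhsP[r r0 Hr].
  pose K := cmod (h z) + 1.
  have K0 : 0 < K by rewrite /K; have := cmod_ge0 (h z); lra.
  (* Near [p] only the bound [K] of |h| is available. For sides shorter than [e / (32 * K)], the
     estimate 4 * K * (w + v) is at most e / 4, which the mass [nu], at least 1/4 here, absorbs. *)
  pose e1 := Num.min (r / 2) (e / (32 * K)).
  have e10 : 0 < e1 by rewrite lt_min !divr_gt0//; lra.
  exists e1 => // x y w v xpa ypb /andP[w_gt0 we] /andP[v_gt0 ve] _ _ _ _.
  have K32 : 0 < 32 * K by lra.
  move: we ve; rewrite !lt_min !(ltr_pdivlMr _ e K32).
  move=> /andP[w1 w2] /andP[v1 v2].
  have [xw yv] : x <= x + w /\ y <= y + v by split; lra.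
  have le1 : cmod (contour h x (x + w) y (y + v)) <= 4 * (K * ((x + w - x) + (y + v - y))).
    apply: (contour_le xw yv (cch _ _ _ _)) => zeta /(near_z x y w v r) => /(_ xpa ypb).
    move=> /(_ ltac:(lra)) [_ /Hr]; rewrite /K => hz _.
    have := cmodD (h zeta - h z) (h z); rewrite subrK; lra.
  apply: le_trans le1 _.
  have n4 : 1 / 2 * (1 / 2) <= nu x (x + w) y (y + v).
    by apply: ler_pM; rewrite ?jump_half -?zp ?rez ?imz//; lra.
  have : 0 <= (w + v) ^+ 2 by exact: sqr_ge0.
  set S := (w + v) ^+ 2 => S0; nra.
have [|d dz] := hd z _ zNp; first by rewrite /rect /= rez imz.
have [r r0 Hr] := dz (e / 4) ltac:(lra).
exists (r / 2); first by lra.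
move=> x y w v xpa ypb wr vr x0x xw y0y yv.
have [lx ly] : x <= x + w /\ y <= y + v by split; lra.
(* The affine approximation has a primitive, so its contour integral vanishes. What remains is at
   most e / 4 * (w + v) on the sides and integrates to at most e * (w + v) ^ 2. *)
pose lin zeta := (h z + d * (zeta - z)) : C.
have clin : continuous lin.
  apply: ccontD; first exact: ccont_cst.
  apply: ccontM; first exact: ccont_cst.
  by apply: ccontD; [move=> ?; exact: cvg_id|exact: ccont_cst].
have ccl : contour_cont lin x (x + w) y (y + v) by exact: contour_cont_total clin.
have ccNl : contour_cont (fun zeta => -1 * lin zeta) x (x + w) y (y + v).
  exact: (contour_contM (contour_cont_cst _ _ _ _ _) ccl).
have hE : contour h x (x + w) y (y + v) =
    contour (fun zeta => (-1) * lin zeta + h zeta) x (x + w) y (y + v).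
  rewrite (contourD ccNl (cch _ _ _ _)) (contourM _ ccl).
  suff -> : contour lin x (x + w) y (y + v) = 0 by rewrite mulr0 add0r.
  apply: (contour_FTC (g := fun zeta => h z * zeta + d / 2%:R * (zeta - z) ^+ 2)).
  by move=> zeta _; exact: cdiff_affine_primitive.
have le1 : cmod (contour h x (x + w) y (y + v)) <=
    4 * (e / 4 * (w + v) * ((x + w - x) + (y + v - y))).
  rewrite hE; apply: (contour_le lx ly (contour_contD ccNl (cch _ _ _ _))).
  move=> zeta rz _.
  have [|c1 c2] := near_z x y w v r zeta xpa ypb _ rz; first by lra.
  have -> : -1 * lin zeta + h zeta = h zeta - h z - d * (zeta - z) by rewrite /lin; ring.
  apply: le_trans (Hr _ _ c2) _.
    by move: rz => [? ?]; rewrite /rect /=; split; lra.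
  by apply: ler_wpM2l => //; lra.
apply: le_trans le1 _.
have := nu_ge0 x (x + w) y (y + v) lx ly.
set N := nu _ _ _ _ => N0.
have : 0 <= e * N by apply: mulr_ge0 => //; exact: ltW.
have -> : 4 * (e / 4 * (w + v) * (x + w - x + (y + v - y))) = e * (w + v) ^+ 2 by field.
by lra.
Qed.

End Goursat.

Section Cauchy.
Context {R : realType}.
Local Notation C := (Cplx R).

Definition square (s : R) : set C := rect (- s) s (- s) s.

Lemma ReIm_mk (x y : R) : Re (x%:C + 'i * y%:C : C) = x /\ Im (x%:C + 'i * y%:C : C) = y.
Proof. by rewrite !ReImE /=; split; ring. Qed.

Lemma compact_square (s : R) : compact (square s).
Proof.
pose g (p : R * R) : C := p.1%:C + 'i * p.2%:C.
have gc : continuous g.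
  apply: ccontD; first by apply: ccont_real => p; exact: cvg_fst.
  by apply: ccontM; [exact: ccont_cst|apply: ccont_real => p; exact: cvg_snd].
have -> : square s = g @` (`[- s, s] `*` `[- s, s]).
  apply/seteqP; split=> [z [h1 h2]|_ [[x y] [/= h1 h2] <-]].
  - exists (Re z, Im z); first by split; rewrite /= in_itv.
    by rewrite /g /=; exact/esym/complexReIm.
  - move: h1 h2; rewrite !in_itv /= => h1 h2.
    by have [rE iE] := ReIm_mk x y; split; [rewrite [Re _]rE|rewrite [Im _]iE].
apply: continuous_compact; first exact: continuous_subspaceT.
by apply: compact_setX; exact: segment_compact.
Qed.

Lemma compact_cmod_bounded (A : set C) (f : C -> C) :
  compact A -> {within A, continuous f} ->
  exists2 M : R, 0 <= M & forall z, A z -> cmod (f z) <= M.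
Proof.
move=> cA fc; have [->|A0] := eqVneq A set0.
  by exists 0.
have [z Az] : A !=set0 by exact/set0P.
have [|c cA' cM] := compact_EVT_max (f := fun z => cmod (f z)) (ex_intro _ z Az) cA.
  by move=> x; apply: continuous_comp; [exact: fc|exact: cmod_continuous].
exists (cmod (f c)); first exact: cmod_ge0.
by move=> w Aw; apply: cM; exact: mem_set.
Qed.

Lemma closed_cmod_le (a : R) : closed [set z : C | cmod z <= a].
Proof.
have -> : [set z : C | cmod z <= a] = @cmod R @^-1` [set x | x <= a] by [].
by apply: closed_comp => [z _|]; [exact: cmod_continuous|exact: closed_le].
Qed.

Definition clampR (s t : R) : R := Num.max (- s) (Num.min s t).

(** A retraction of the plane onto the square. Composing with it yields a function continuous
    everywhere, unchanged on the square, where relative differentiability, the hypothesis of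
    [goursat], survives. *)
Definition clamp (s : R) (z : C) : C := (clampR s (Re z))%:C + 'i * (clampR s (Im z))%:C.

Lemma clampR_in (s t : R) : 0 <= s -> - s <= clampR s t <= s.
Proof. by move=> s0; rewrite /clampR le_max lexx /= ge_max ge_min lexx /= andbT; lra. Qed.

Lemma clampR_id (s t : R) : - s <= t <= s -> clampR s t = t.
Proof. by move=> /andP[h1 h2]; rewrite /clampR min_r// max_r. Qed.

Lemma clamp_in (s : R) (z : C) : 0 <= s -> square s (clamp s z).
Proof.
move=> s0; have := clampR_in (Re z) s0; have := clampR_in (Im z) s0.
have [rE iE] := ReIm_mk (clampR s (Re z)) (clampR s (Im z)).
by split; [rewrite [Re _]rE|rewrite [Im _]iE].
Qed.

Lemma clamp_id (s : R) (z : C) : square s z -> clamp s z = z.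
Proof.
by move=> [h1 h2]; rewrite /clamp !clampR_id// -complexReIm.
Qed.

Lemma clamp_continuous (s : R) : continuous (clamp s).
Proof.
have cc : continuous (clampR s).
  move=> t.
  have h : {for t, continuous ((cst s : R -> R) \min id)}.
    by apply: continuous_min; [exact: cvg_cst|exact: cvg_id].
  exact: (continuous_max (cvg_cst _) h).
apply: ccontD.
  by apply: ccont_real => z; apply: continuous_comp; [exact: Re_continuous|exact: cc].
apply: ccontM; first exact: ccont_cst.
by apply: ccont_real => z; apply: continuous_comp; [exact: Im_continuous|exact: cc].
Qed.

Lemma square_cmod (s : R) (z : C) : square s z -> cmod z <= 2 * s.
Proof.
move=> [h1 h2]; apply: le_trans (cmod_le_ReIm z) _.
rewrite -!ler_norml in h1 h2; lra.
Qed.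

Lemma on_lines_cmod (s : R) (z : C) : 0 < s -> on_lines (- s) s (- s) s z -> s <= cmod z.
Proof.
by move=> s0 [] E; have := Re_le_cmod z; have := Im_le_cmod z; rewrite E ?normrN (gtr0_norm s0).
Qed.

(** Filling in the derivative makes the difference quotient continuous at [z]; its differentiability
    there is not yet available, which is why [goursat] allows an exceptional point. *)
Definition slope (f : C -> C) (z v : C) : C :=
  if v == z then derive1 f z else (f v - f z) / (v - z).

Lemma slope_continuous (f : C -> C) (z w : C) (r : R) :
  (forall v, cmod v < r -> derivable f v 1) -> cmod z < r -> cmod w < r ->
  {for w, continuous (slope f z)}.
Proof.
move=> fd zr wr.
have [->|wNz] := eqVneq w z.
  have /derivable_cdiff dz := fd _ zr.
  apply/ccontP => e e0; have [d d0 Hd] := dz (e / 2) ltac:(lra).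
  apply/cnbhsP; exists d => // v vd; rewrite /slope eqxx.
  case: eqVneq => [_|vz]; first by rewrite subrr cmod0.
  have vz0 : v - z != 0 by rewrite subr_eq0.
  have -> : (f v - f z) / (v - z) - derive1 f z =
      (f v - f z - derive1 f z * (v - z)) / (v - z) by field.
  have n0 : 0 < cmod (v - z) by rewrite cmod_gt0.
  rewrite cmodM cmodV ltr_pdivrMr//; apply: le_lt_trans (Hd _ vd) _.
  by rewrite ltr_pM2r//; lra.
have wz0 : w - z != 0 by rewrite subr_eq0.
have fc : {for w, continuous f} by exact: cdiff_cont (derivable_cdiff (fd _ wr)).
have qc : {for w, continuous (fun v => (f v - f z) * (v - z)^-1)}.
  have h1 : {for w, continuous (fun v => f v - f z)} by exact: cvgB fc (cvg_cst _).
  have h2 : {for w, continuous (fun v : C => v - z)} by exact: cvgB cvg_id (cvg_cst _).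
  by exact: cvgM h1 (cvgV wz0 h2).
have E : \forall v \near w, (f v - f z) * (v - z)^-1 = slope f z v.
  apply/cnbhsP; exists (cmod (w - z)); first by rewrite cmod_gt0.
  move=> v; rewrite /slope; by case: eqVneq => // ->; rewrite cmodBC ltxx.
have qw : slope f z w = (f w - f z) * (w - z)^-1 by rewrite /slope (negbTE wNz).
rewrite /prop_for /continuous_at qw.
exact: cvg_trans (near_eq_cvg E) qc.
Qed.

Lemma slope_cdiff (f : C -> C) (z w : C) (r : R) :
  (forall v, cmod v < r -> derivable f v 1) -> cmod w < r -> w != z ->
  exists d, cdiff (slope f z) w d.
Proof.
move=> fd wr wNz.
have wz0 : w - z != 0 by rewrite subr_eq0.
have qd : derivable (fun v => (f v - f z) * (v - z)^-1) w 1.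
  apply: derivableM.
    by apply: derivableB; [exact: fd|exact: derivable_cst].
  apply: derivableV; first exact: wz0.
  by apply: derivableB; [exact: derivable_id|exact: derivable_cst].
have E : \forall v \near w, (f v - f z) * (v - z)^-1 = slope f z v.
  apply/cnbhsP; exists (cmod (w - z)); first by rewrite cmod_gt0.
  move=> v; rewrite /slope; by case: eqVneq => // ->; rewrite cmodBC ltxx.
have dq : derivable (slope f z) w 1 by exact: near_eq_derivable E qd.
have := derivable_cdiff dq; set d := derive1 _ _ => cd; exists d; exact: cd.
Qed.

Lemma cdiff_exprVn (n : nat) (z : C) : z != 0 ->
  cdiff (fun w => - (n.+1)%:R^-1 * w ^- n.+1) z (z ^- n.+2).
Proof.
move=> z0; apply: is_derive_cdiff.
have di : is_derive z (1 : C) (fun w : C => w^-1) (- z ^- 2).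
  apply: DeriveDef; first by apply: derivableV; [exact: z0|exact: derivable_id].
  by rewrite deriveV ?derive_id; [exact: mulr1|exact: z0|exact: derivable_id].
have dZ := is_deriveZ (- (n.+1)%:R^-1) (is_deriveX n.+1 di).
have -> : (fun w : C => - (n.+1)%:R^-1 * w ^- n.+1) =
    (- (n.+1)%:R^-1) *: (fun w : C => w^-1) ^+ n.+1.
  by apply/funext => w; rewrite -[RHS]/(_ * ((fun v : C => v^-1) ^+ n.+1) w) exprfctE exprVn.
apply: (is_derive_eq dZ).
have n0 : (n.+1)%:R != 0 :> C by rewrite pnatr_eq0.
change (- (n.+1)%:R^-1 * ((n.+1)%:R * z^-1 ^+ n * - z ^- 2) = z ^- n.+2).
rewrite exprVn (exprD z 2 n).
by field; rewrite expf_neq0// z0 nat1r n0.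
Qed.

End Cauchy.

(** * Cauchy's expansion on a disc *)

Section CauchySeries.
Context {R : realType}.
Local Notation C := (Cplx R).
Variables (f : C -> C) (r s : R).
Hypotheses (s0 : 0 < s) (sr : 2 * s < r).
Hypothesis fd : forall z, cmod z < r -> derivable f z 1.

Local Notation ct h := (contour h (- s) s (- s) s).
Local Notation cc h := (contour_cont h (- s) s (- s) s).
Local Notation bd := (on_lines (- s) s (- s) s).

Let ss : - s <= s. Proof. by have := s0; lra. Qed.

Let square_disc z : square s z -> cmod z < r.
Proof. by move=> /square_cmod; have := sr; lra. Qed.

Let fs (z : C) := f (clamp s z).

Let fs_cont : continuous fs.
Proof.
move=> z; apply: continuous_comp; first exact: clamp_continuous.
by apply/cdiff_cont/derivable_cdiff/fd/square_disc/clamp_in/ltW.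
Qed.

Let fs_cc : cc fs. Proof. exact: (contour_cont_total _ _ _ _ fs_cont). Qed.

Let bd_neq0 z : bd z -> z != 0.
Proof. by move=> /(on_lines_cmod s0) sz; rewrite -cmod_gt0; have := s0; lra. Qed.

Let inv_cc n : cc (fun z => z ^- n).
Proof.
apply: contour_contP => z /bd_neq0 z0.
have h : {for z, continuous (fun x : C => x ^+ n)}.
  by apply: (@ccontX R C idfun) => x; exact: cvg_id.
exact: (cvgV (expf_neq0 n z0) h).
Qed.

(* Plays the role of 2 i pi; only a lower bound of its modulus is used. *)
Let kappa : C := ct (fun z => z ^- 1).

(** Each side contributes at least 1 to the imaginary part: the integrand there has imaginary part s
    / (t ^ 2 + s ^ 2), at least 1 / (2 * s), over a length 2 * s. *)
Let kappa_ge4 : 4 <= cmod kappa.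
Proof.
have s_gt0 := s0; apply: le_trans (Im_le_cmod _); apply: le_trans (ler_norm _).
have [c1 c2 c3 c4] := inv_cc 1.
have s2 : 0 < 2 * s ^+ 2 by rewrite mulr_gt0 ?exprn_gt0.
have sq (t : R) : - s <= t <= s -> t ^+ 2 <= s ^+ 2.
  by move=> h; rewrite -ler_sqrt ?sqr_ge0// !sqrtr_sqr (gtr0_norm s0) ler_norml.
have key (g : R -> C) : continuous g ->
    (forall t, - s <= t <= s -> s / (2 * s ^+ 2) <= Im (g t)) ->
    1 <= Im (cint g (- s) s).
  move=> gc gt; rewrite Im_cint.
  have [t /gt h ->] := rint_MVT (Im_cont gc) ss.
  have -> : 1 = s / (2 * s ^+ 2) * (s - - s) by field; lra.
  by rewrite ler_pM2r; lra.
have invE (a b : R) : a ^+ 2 + b ^+ 2 != 0 ->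
    ((a +i* b)%C : C)^-1 = ((a / (a ^+ 2 + b ^+ 2)) +i* (- (b / (a ^+ 2 + b ^+ 2))))%C.
  by [].
have den (a b : R) : - s <= a <= s -> b ^+ 2 = s ^+ 2 ->
    s / (2 * s ^+ 2) <= s / (a ^+ 2 + b ^+ 2) /\ a ^+ 2 + b ^+ 2 != 0.
  move=> /sq ha hb; have := sqr_ge0 a => a0.
  have h : 0 < a ^+ 2 + b ^+ 2 by lra.
  split; last by rewrite gt_eqF.
  by rewrite ler_pM2l// lef_pV2 ?posrE//; lra.
have L1 : 1 <= Im (seg (fun z : C => z ^- 1) (hline (- s)) 1 (- s) s).
  apply: (key _ (segcont_mulr c1)) => t ts.
  have -> : hline (- s) + t%:C * 1 = (t +i* (- s))%C :> C.
    by apply: complex_eqP; rewrite !ReImE /=; ring.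
  have [|le1 n0] := den t (- s) ts; first by rewrite sqrrN.
  rewrite expr1 (invE _ _ n0) !ReImE /=; apply: le_trans le1 _.
  by rewrite le_eqVlt; apply/orP; left; apply/eqP; ring.
have L2 : 1 <= Im (- seg (fun z : C => z ^- 1) (hline s) 1 (- s) s).
  rewrite -mulN1r -(segM _ _ _ c2).
  have cN : segcont (fun z : C => -1 * z ^- 1) (hline s) 1 by exact: (ccontM (@ccont_cst _ _ _) c2).
  apply: (key _ (segcont_mulr cN)) => t ts.
  have -> : hline s + t%:C * 1 = (t +i* s)%C :> C.
    by apply: complex_eqP; rewrite !ReImE /=; ring.
  have [|le1 n0] := den t s ts; first by [].
  rewrite expr1 (invE _ _ n0) !ReImE /=; apply: le_trans le1 _.
  by rewrite le_eqVlt; apply/orP; left; apply/eqP; ring.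
have L3 : 1 <= Im (seg (fun z : C => z ^- 1) (vline s) 'i (- s) s).
  apply: (key _ (segcont_mulr c3)) => t ts.
  have -> : vline s + t%:C * 'i = (s +i* t)%C :> C.
    by apply: complex_eqP; rewrite !ReImE /=; ring.
  have [|le1] := den t s ts; first by [].
  rewrite addrC => n0.
  rewrite expr1 (invE _ _ n0) !ReImE /=; apply: le_trans le1 _.
  by rewrite addrC le_eqVlt; apply/orP; left; apply/eqP; ring.
have L4 : 1 <= Im (- seg (fun z : C => z ^- 1) (vline (- s)) 'i (- s) s).
  rewrite -mulN1r -(segM _ _ _ c4).
  have cN : segcont (fun z : C => -1 * z ^- 1) (vline (- s)) 'i.
    by exact: (ccontM (@ccont_cst _ _ _) c4).
  apply: (key _ (segcont_mulr cN)) => t ts.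
  have -> : vline (- s) + t%:C * 'i = ((- s) +i* t)%C :> C.
    by apply: complex_eqP; rewrite !ReImE /=; ring.
  have [|le1] := den t (- s) ts; first by rewrite sqrrN.
  rewrite addrC => n0.
  rewrite expr1 (invE _ _ n0) !ReImE /=; apply: le_trans le1 _.
  by rewrite addrC le_eqVlt; apply/orP; left; apply/eqP; ring.
rewrite /kappa /contour !ImD (_ : 4 = 1 + 1 + (1 + 1)); last by ring.
exact: lerD (lerD L1 L2) (lerD L3 L4).
Qed.

Let contour_invXn n : ct (fun z => z ^- n.+2) = 0.
Proof.
apply: (contour_FTC (g := fun w => - (n.+1)%:R^-1 * w ^- n.+1)) => z /bd_neq0.
exact: cdiff_exprVn.
Qed.

Let b n : C := ct (fun z => fs z * z ^- n.+1).

(** On the sides |z| >= s, so [contour_le] gives 4 * (M / s ^ n.+1) * (4 * s). Dividing by [kappa],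
    of modulus at least 4, later turns 16 into 4. *)
Let b_le (M : R) n : (forall z, square s z -> cmod (f z) <= M) ->
  cmod (b n) * s ^+ n <= 16 * M.
Proof.
move=> fM; have s_gt0 := s0; have sn0 : 0 < s ^+ n.+1 by exact: exprn_gt0.
have M0 : 0 <= M.
  apply: le_trans (fM 0 _); first exact: cmod_ge0.
  by rewrite /square /rect /=; split; lra.
have le1 : cmod (b n) <= 4 * (M / s ^+ n.+1 * (s - - s + (s - - s))).
  apply: (contour_le ss ss (contour_contM fs_cc (inv_cc _))) => z rz lz.
  rewrite cmodM cmodV cmodX; apply: ler_pM; rewrite ?cmod_ge0 ?invr_ge0 ?exprn_ge0 ?cmod_ge0//.
    by rewrite /fs clamp_id//; exact: fM.
  have sz := on_lines_cmod s0 lz.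
  rewrite lef_pV2 ?posrE ?exprn_gt0//; last by lra.
  by apply: lerXn2r; rewrite ?nnegrE; lra.
apply: le_trans (ler_wpM2r _ le1) _; first exact/ltW/exprn_gt0.
rewrite le_eqVlt; apply/orP; left; apply/eqP; rewrite exprS.
by field; rewrite expf_neq0 gt_eqF.
Qed.

Section AtPoint.
Variable z : C.
Hypothesis zs : cmod z < s.

Let zr : cmod z < r.
Proof. by have := s0; have := sr; have := zs; lra. Qed.

Let bd_neq v : bd v -> v - z != 0.
Proof.
move=> /(on_lines_cmod s0) sv; rewrite subr_eq0; apply/eqP => vz.
by have := zs; rewrite -vz; lra.
Qed.

Let G (v : C) : C := (fs v + - f z) * (v - z)^-1.

Let fz_cc : cc (fun v => fs v + - f z).
Proof. exact: (contour_contD fs_cc (contour_cont_cst _ _ _ _ _)). Qed.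

Let G_cc : cc G.
Proof.
apply: (contour_contM fz_cc); apply: contour_contP => v /bd_neq v0.
have h : {for v, continuous (fun v : C => v - z)} by exact: cvgB cvg_id (cvg_cst _).
exact: cvgV v0 h.
Qed.

(** On the sides [G] coincides with the clamped difference quotient of [f] at [z], to which
    Goursat's theorem applies with exceptional point [z]. *)
Let G0 : ct G = 0.
Proof.
have s_gt0 := s0.
have sE : s = - s + 2 * s by lra.
have qc : continuous (slope f z \o clamp s).
  move=> v; apply: continuous_comp; first exact: clamp_continuous.
  exact: (slope_continuous fd zr (square_disc (clamp_in _ (ltW s0)))).
have <- : ct (slope f z \o clamp s) = ct G.
  apply: (contour_eq ss ss _ G_cc); first exact: contour_cont_total.
  move=> v rv lv; rewrite /= /G /fs clamp_id// /slope.
  by have := bd_neq lv; rewrite subr_eq0 => /negbTE ->.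
rewrite [X in contour _ _ X _ _]sE [X in contour _ _ _ _ X]sE.
apply: (goursat (p := z)) => //; try lra.
rewrite -sE => w rw wz.
have [d dw] := slope_cdiff fd (square_disc rw) wz.
exists d => e /dw[t t0 Ht]; exists t => // v rv /Ht.
by rewrite /= !clamp_id.
Qed.

Let D N : C := ct (fun v => G v * (z ^+ N * v ^- N)).

Let zX_cc N : cc (fun v => z ^+ N * v ^- N).
Proof. exact: (contour_contM (contour_cont_cst _ _ _ _ _) (inv_cc _)). Qed.

Let GX_cc N : cc (fun v => G v * (z ^+ N * v ^- N)).
Proof. exact: (contour_contM G_cc (zX_cc N)). Qed.

Let k N : C := ct (fun v => v ^- N.+1).

(** One step of the geometric expansion of 1 / (v - z): the factor 1 - z / v = (v - z) / v cancels
    the denominator of [G]. *)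
Let DS N : D N = D N.+1 + z ^+ N * (b N + - f z * k N).
Proof.
have c1 : cc (fun v => fs v * v ^- N.+1) by exact: (contour_contM fs_cc (inv_cc _)).
have c2 : cc (fun v => - f z * v ^- N.+1).
  exact: (contour_contM (contour_cont_cst _ _ _ _ _) (inv_cc _)).
have c3 := contour_contD c1 c2.
have c4 : cc (fun v => z ^+ N * (fs v * v ^- N.+1 + - f z * v ^- N.+1)).
  exact: (contour_contM (contour_cont_cst _ _ _ _ _) c3).
rewrite /D /b /k -(contourM _ (inv_cc _)) -(contourD c1 c2) -(contourM _ c3).
rewrite -(contourD (GX_cc _) c4).
apply: (contour_eq ss ss (GX_cc _) (contour_contD (GX_cc _) c4)) => v _ lv.
have v0 := bd_neq0 lv; have vz := bd_neq lv.
rewrite /G !exprS; field.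
by rewrite vz v0 expf_neq0.
Qed.

(** [DS] telescopes from [D 0], which is the vanishing integral of [G]. Only [k 0], that is [kappa],
    survives among the [k n], the others being integrals of functions with a primitive. *)
Let DE N : \sum_(n < N.+1) z ^+ n * b n - f z * kappa = - D N.+1.
Proof.
elim: N => [|N IH].
  rewrite big_ord1 expr0 mul1r.
  have D0 : D 0%N = 0.
    apply: etrans G0.
    have E : (fun v => G v * (z ^+ 0 * v ^- 0)) = G.
      by apply/funext => v; rewrite !expr0 invr1 mulr1; exact: mulr1.
    by rewrite /D E.
  have := DS 0%N; rewrite D0.
  rewrite expr0 mul1r => /esym/eqP; rewrite addr_eq0 => /eqP ->.
  by rewrite opprK mulNr.
rewrite big_ord_recr /= addrAC IH (DS N.+1) /k contour_invXn.
by ring.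
Qed.

(** On the sides |z / v| <= |z| / s < 1 while [G] is bounded, so the remainder [D N.+1] decays
    geometrically. *)
Lemma cauchy_remainder : exists K q : R, 0 <= q < 1 /\ forall N,
  cmod (\sum_(n < N.+1) b n / kappa * z ^+ n - f z) <= K * q ^+ N.
Proof.
have s_gt0 := s0; have zs' := zs.
have [M M0 HM] : exists2 M : R, 0 <= M & forall v, square s v -> cmod (fs v) <= M.
  apply: compact_cmod_bounded; first exact: compact_square.
  exact: continuous_subspaceT.
have sz0 : 0 < s - cmod z by lra.
pose L := (M + cmod (f z)) / (s - cmod z).
have GL v : square s v -> bd v -> cmod (G v) <= L.
  move=> sv lv; rewrite cmodM cmodV.
  have h1 := on_lines_cmod s0 lv.
  have h2 : s - cmod z <= cmod (v - z).
    by have := cmodD (v - z) z; rewrite subrK; lra.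
  apply: ler_pM; rewrite ?cmod_ge0 ?invr_ge0 ?cmod_ge0//.
    by apply: le_trans (cmodB _ _) _; rewrite lerD2r HM.
  by rewrite lef_pV2 ?posrE//; lra.
have q0 : 0 <= cmod z / s by rewrite divr_ge0// ?cmod_ge0// ltW.
have L0 : 0 <= L by apply: divr_ge0; [apply: addr_ge0 => //; exact: cmod_ge0|exact: ltW].
have q1 : cmod z / s < 1 by rewrite ltr_pdivrMr// mul1r.
have kp : 0 < cmod kappa by have := kappa_ge4; lra.
have kN0 : kappa != 0 by rewrite -cmod_gt0.
exists (4 * (L * (s - - s + (s - - s))) / cmod kappa), (cmod z / s).
split; first by rewrite q0.
move=> N.
have -> : \sum_(n < N.+1) b n / kappa * z ^+ n - f z = - D N.+1 / kappa.
  rewrite -DE mulrBl mulfK// mulr_suml; congr (_ - _).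
  by apply: eq_bigr => n _; rewrite mulrC mulrA.
rewrite mulNr cmodN cmodM cmodV mulrAC ler_pM2r ?invr_gt0//.
have : cmod (D N.+1) <= 4 * (L * (cmod z / s) ^+ N * (s - - s + (s - - s))).
  apply: (contour_le ss ss (GX_cc _)) => v sv lv.
  rewrite cmodM; apply: ler_pM; rewrite ?cmod_ge0//; first exact: GL.
  rewrite cmodM cmodV !cmodX -exprVn -exprMn.
  have h1 := on_lines_cmod s0 lv.
  apply: (@le_trans _ _ ((cmod z / s) ^+ N.+1)).
    apply: lerXn2r; rewrite ?nnegrE// ?mulr_ge0 ?invr_ge0 ?cmod_ge0//.
    by rewrite ler_wpM2l ?cmod_ge0// lef_pV2 ?posrE//; lra.
  by rewrite exprS ler_piMl ?exprn_ge0// ltW.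
by move/le_trans; apply; rewrite le_eqVlt; apply/orP; left; apply/eqP; ring.
Qed.

End AtPoint.

Lemma cauchy_series : exists c : nat -> C,
  (forall z, cmod z < s -> exists K q : R, 0 <= q < 1 /\ forall N,
     cmod (\sum_(n < N.+1) c n * z ^+ n - f z) <= K * q ^+ N) /\
  (forall M, (forall z, square s z -> cmod (f z) <= M) ->
     forall n, cmod (c n) * s ^+ n <= 4 * M).
Proof.
exists (fun n => b n / kappa); split=> [z|M /b_le bM n].
  exact: cauchy_remainder.
have k4 := kappa_ge4; have kp : 0 < cmod kappa by lra.
rewrite cmodM cmodV mulrAC ler_pdivrMr//; apply: le_trans (bM n) _.
have sn0 : 0 <= s ^+ n by rewrite exprn_ge0// ltW// s0.
have : 0 <= 16 * M by apply: le_trans (bM n); rewrite mulr_ge0 ?cmod_ge0.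
by nra.
Qed.

End CauchySeries.

(** * Power series *)

Section Series.
Context {R : realType}.
Local Notation C := (Cplx R).
Implicit Types (u v c : nat -> C).

Lemma geometric_small (K q e : R) : 0 <= q < 1 -> 0 < e ->
  exists N0, forall N, (N0 <= N)%N -> K * q ^+ N <= e.
Proof.
move=> /andP[q0 q1] e0.
have /cvgrPdist_le/(_ _ e0)[N0 _ H] : (geometric K q : nat -> R) @ \oo --> (0 : R).
  by apply: cvg_geometric; rewrite ger0_norm.
exists N0 => N /H /=; rewrite sub0r normrN; apply: le_trans; exact: ler_norm.
Qed.

Definition csums u (s : C) := forall e : R, 0 < e ->
  exists N0, forall N, (N0 <= N)%N -> cmod (\sum_(n < N) u n - s) <= e.

Lemma csums_uniq u s t : csums u s -> csums u t -> s = t.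
Proof.
move=> us ut; apply/eqP; rewrite -subr_eq0 -cmod_eq0 eq_le cmod_ge0 andbT.
apply/ler_addgt0Pl => e e0; rewrite addr0.
have e2 : 0 < e / 2 by lra.
have [N1 H1] := us _ e2; have [N2 H2] := ut _ e2.
have := H1 _ (leq_maxl N1 N2); have := H2 _ (leq_maxr N1 N2).
set S := \sum_(n < _) _ => h2 h1.
have -> : s - t = (S - t) - (S - s) by ring.
by apply: le_trans (cmodB _ _) _; lra.
Qed.

Lemma csumsD u v s t : csums u s -> csums v t -> csums (fun n => u n + v n) (s + t).
Proof.
move=> us ut e e0; have e2 : 0 < e / 2 by lra.
have [N1 H1] := us _ e2; have [N2 H2] := ut _ e2.
exists (maxn N1 N2) => N; rewrite geq_max => /andP[/H1 h1 /H2 h2].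
rewrite big_split /= opprD addrACA.
by apply: le_trans (cmodD _ _) _; lra.
Qed.

Lemma csumsM (a : C) u s : csums u s -> csums (fun n => a * u n) (a * s).
Proof.
move=> us e e0; have K0 : 0 < cmod a + 1 by have := cmod_ge0 a; lra.
have [N1 H1] := us _ (divr_gt0 e0 K0).
exists N1 => N /H1; rewrite -mulr_sumr -mulrBr cmodM ler_pdivlMr//.
set X := cmod (_ - _) => h; apply: le_trans h.
by have := cmod_ge0 (\sum_(n < N) u n - s); rewrite -/X => X0; nra.
Qed.

Lemma csums_recl u t : csums (fun n => u n.+1) t -> csums u (u 0%N + t).
Proof.
move=> ut e e0; have [N1 H1] := ut _ e0.
exists N1.+1 => -[//|N]; rewrite ltnS => /H1.
by rewrite big_ord_recl /= opprD addrACA subrr add0r.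
Qed.

Lemma csums_le u s (M q : R) : 0 <= q < 1 -> (forall n, cmod (u n) <= M * q ^+ n) ->
  csums u s -> cmod s <= M / (1 - q).
Proof.
move=> /andP[q0 q1] uM us; apply/ler_addgt0Pl => e e0.
have [N H] := us _ e0; have := H N (leqnn N).
set S := \sum_(n < N) u n => h.
have M0 : 0 <= M by have := uM 0%N; rewrite expr0 mulr1; apply: le_trans; exact: cmod_ge0.
have q1' : 0 < 1 - q by lra.
have SM : cmod S <= M / (1 - q).
  apply: le_trans (cmod_sum _ _ _) _.
  apply: (@le_trans _ _ (\sum_(n < N) M * q ^+ n)); first exact: ler_sum.
  rewrite -mulr_sumr ler_wpM2l// -[leRHS]mul1r ler_pdivlMr//.
  have qN : 0 <= q ^+ N by rewrite exprn_ge0.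
  by have := subrX1 q N; lra.
have -> : s = S - (S - s) by ring.
by apply: le_trans (cmodB _ _) _; lra.
Qed.

Lemma real_series_exists (x : nat -> R) (M q : R) : 0 <= q < 1 ->
  (forall n, `|x n| <= M * q ^+ n) -> exists l : R, forall e : R, 0 < e ->
    exists N0, forall N, (N0 <= N)%N -> `|\sum_(n < N) x n - l| <= e.
Proof.
move=> /andP[q0 q1] xM.
have gc : cvgn (series (geometric M q)).
  by apply: is_cvg_geometric_series; rewrite ger0_norm.
have xc : cvgn (series x).
  apply: normed_cvg; apply: (series_le_cvg _ _ _ gc) => n //=.
  by apply: le_trans (xM n); exact: normr_ge0.
exists (limn (series x)) => e e0.
have /cvgrPdist_le/(_ _ e0)[N0 _ H] := xc.
exists N0 => N /H; rewrite distrC seriesEord; exact.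
Qed.

Lemma csums_exists u (M q : R) : 0 <= q < 1 ->
  (forall n, cmod (u n) <= M * q ^+ n) -> exists s, csums u s.
Proof.
move=> q01 uM.
have [|a Ha] := @real_series_exists (fun n => Re (u n)) M q q01.
  by move=> n; apply: le_trans (uM n); exact: Re_le_cmod.
have [|b Hb] := @real_series_exists (fun n => Im (u n)) M q q01.
  by move=> n; apply: le_trans (uM n); exact: Im_le_cmod.
exists (a%:C + 'i * b%:C) => e e0; have e2 : 0 < e / 2 by lra.
have [N1 H1] := Ha _ e2; have [N2 H2] := Hb _ e2.
exists (maxn N1 N2) => N; rewrite geq_max => /andP[/H1 h1 /H2 h2].
apply: le_trans (cmod_le_ReIm _) _.
have [rE iE] := ReIm_mk a b.
have rS : Re (\sum_(n < N) u n) = \sum_(n < N) Re (u n).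
  by elim/big_ind2 : _ => // x y z t <- <-; rewrite ReD.
have iS : Im (\sum_(n < N) u n) = \sum_(n < N) Im (u n).
  by elim/big_ind2 : _ => // x y z t <- <-; rewrite ImD.
rewrite ReD ReN ImD ImN rE iE rS iS; lra.
Qed.

(** (1 - x ^ k) / (1 - x) is a sum of k powers, each at least x ^ k. The bound lets a slightly
    larger radius absorb the factor k of a termwise derivative. *)
Lemma nat_geometric (x : R) k : 0 <= x < 1 -> k%:R * x ^+ k <= (1 - x)^-1.
Proof.
move=> /andP[x0 x1]; have x1' : 0 < 1 - x by lra.
rewrite -[leRHS]mul1r ler_pdivlMr//.
suff : k%:R * x ^+ k * (1 - x) <= 1 - x ^+ k.
  by move/le_trans; apply; rewrite gerBl exprn_ge0.
elim: k => [|k IH]; first by rewrite mul0r mul0r expr0 subrr.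
have xk1 : x ^+ k.+1 <= 1 by rewrite exprn_ile1// ltW.
have xk0 : 0 <= x ^+ k by rewrite exprn_ge0.
rewrite -natr1 exprS in xk1 *; nra.
Qed.

End Series.

Section PowerSeries.
Context {R : realType}.
Local Notation C := (Cplx R).
Implicit Types (c : nat -> C) (rho : R).

(** Abel's form of a radius of convergence at least [rho]. Unlike boundedness at [rho] itself, it is
    stable under termwise differentiation. *)
Definition bounded_coef c rho := forall t : R, 0 < t < rho ->
  exists2 M : R, 0 <= M & forall k, cmod (c k) * t ^+ k <= M.

Definition psum c (w : C) : C := xget 0 [set s | csums (fun k => c k * w ^+ k) s].

Definition dcoef c : nat -> C := fun k => k.+1%:R * c k.+1.

Lemma real_between (a b : R) : a < b -> exists2 x, a < x & x < b.
Proof. by move=> ab; exists ((a + b) / 2); lra. Qed.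

Lemma psumP c rho w : bounded_coef c rho -> cmod w < rho ->
  csums (fun k => c k * w ^+ k) (psum c w).
Proof.
move=> bc wr; have w0 := cmod_ge0 w; pose t := (cmod w + rho) / 2.
have [|M M0 HM] := bc t; first by rewrite /t; lra.
have t0 : 0 < t by rewrite /t; lra.
suff : exists s, csums (fun k => c k * w ^+ k) s.
  exact: (@xgetPex _ 0 [set s | csums (fun k => c k * w ^+ k) s]).
apply: (@csums_exists R _ M (cmod w / t)).
  by rewrite divr_ge0//= ?ltr_pdivrMr// ?mul1r /t; lra.
move=> k; rewrite cmodM cmodX expr_div_n mulrA ler_pdivlMr ?exprn_gt0// mulrAC.
by rewrite ler_wpM2r ?exprn_ge0.
Qed.

Lemma psum_eq c w s : csums (fun k => c k * w ^+ k) s -> psum c w = s.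
Proof.
move=> cs; apply: (csums_uniq _ cs).
exact: (@xgetPex _ 0 [set s | csums (fun k => c k * w ^+ k) s] (ex_intro _ s cs)).
Qed.

Lemma psum_at0 c : psum c 0 = c 0%N.
Proof.
apply: psum_eq => e e0; exists 1%N => -[//|N] _.
rewrite big_ord_recl /= expr0 mulr1 big1; last by move=> i _; rewrite exprS mul0r mulr0.
by rewrite addr0 subrr cmod0 ltW.
Qed.

Lemma bounded_dcoef c rho : bounded_coef c rho -> bounded_coef (dcoef c) rho.
Proof.
move=> bc t /andP[t0 tr]; have [t1 tt1 t1r] := real_between tr.
have t10 : 0 < t1 by lra.
have [|M M0 HM] := bc t1; first by lra.
have q01 : 0 <= t / t1 < 1 by rewrite divr_ge0 ?ltr_pdivrMr ?mul1r ?tt1 ?ltW.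
exists (M * (1 - t / t1)^-1 / t).
  by apply: divr_ge0; [apply: mulr_ge0 => //; rewrite invr_ge0; lra|exact: ltW].
move=> k; rewrite /dcoef cmodM cmod_nat ler_pdivlMr//.
have -> : k.+1%:R * cmod (c k.+1) * t ^+ k * t =
    cmod (c k.+1) * t1 ^+ k.+1 * (k.+1%:R * (t / t1) ^+ k.+1).
  by rewrite expr_div_n !exprS; field; rewrite expf_neq0 ?gt_eqF.
apply: ler_pM; rewrite ?mulr_ge0 ?cmod_ge0 ?exprn_ge0 ?ler0n ?(ltW t10)//.
  by case/andP: q01.
exact: nat_geometric.
Qed.

(** The second order Taylor bound of a power; the factor [t ^+ 2] on the left avoids the exponent k
    - 2, and at k = 0 the truncated [k.-1] is multiplied by 0. *)
Lemma taylor_power (v w : C) (t : R) k : cmod v <= t -> cmod w <= t -> 0 < t ->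
  cmod (v ^+ k - w ^+ k - (v - w) * (k%:R * w ^+ k.-1)) * t ^+ 2
    <= cmod (v - w) ^+ 2 * (k%:R ^+ 2 * t ^+ k).
Proof.
move=> vt wt t0; elim: k => [|k IH].
  rewrite !expr0 mul0r mulr0 subrr subr0 cmod0 mul0r mulr1.
  by apply: mulr_ge0; apply: exprn_ge0; rewrite ?cmod_ge0.
have -> : v ^+ k.+1 - w ^+ k.+1 - (v - w) * (k.+1%:R * w ^+ k) =
    v * (v ^+ k - w ^+ k - (v - w) * (k%:R * w ^+ k.-1))
    + (v - w) ^+ 2 * (k%:R * w ^+ k.-1).
  case: k {IH} => [|k] /=; first by rewrite !expr1 !expr0; ring.
  by rewrite -!natr1 !exprS; ring.
set A := v ^+ k - w ^+ k - _ in IH *; set h2 := cmod (v - w) ^+ 2 in IH *.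
have h20 : 0 <= h2 by rewrite exprn_ge0 ?cmod_ge0.
have tk0 : 0 <= t ^+ k by rewrite exprn_ge0// ltW.
have B : cmod ((v - w) ^+ 2 * (k%:R * w ^+ k.-1)) * t ^+ 2 <= h2 * (k%:R * t ^+ k.+1).
  rewrite !cmodM !cmodX cmod_nat -/h2 -mulrA ler_wpM2l// -mulrA.
  case: k {IH A tk0} => [|k]; first by rewrite !mul0r.
  rewrite ler_wpM2l ?ler0n//=.
  have : cmod w ^+ k <= t ^+ k by apply: lerXn2r; rewrite ?nnegrE ?cmod_ge0// ltW.
  have -> : t ^+ k.+2 = t ^+ k * t ^+ 2 by rewrite -exprD addn2.
  by apply: ler_wpM2r; rewrite exprn_ge0// ltW.
have A1 : cmod (v * A) * t ^+ 2 <= h2 * (k%:R ^+ 2 * t ^+ k.+1).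
  rewrite cmodM -mulrA [t ^+ k.+1]exprS.
  have -> : h2 * (k%:R ^+ 2 * (t * t ^+ k)) = t * (h2 * (k%:R ^+ 2 * t ^+ k)) by ring.
  by apply: ler_pM; rewrite ?mulr_ge0 ?cmod_ge0 ?exprn_ge0// ltW.
have t20 : 0 <= t ^+ 2 by rewrite exprn_ge0// ltW.
apply: le_trans (ler_wpM2r t20 (cmodD _ _)) _.
rewrite mulrDl; apply: le_trans (lerD A1 B) _.
rewrite -mulrDr ler_wpM2l// -mulrDl ler_wpM2r ?exprn_ge0 ?(ltW t0)//.
have k0 : 0 <= k%:R :> R by rewrite ler0n.
by rewrite -natr1; nra.
Qed.

Lemma psum_cdiff c rho w : bounded_coef c rho -> cmod w < rho ->
  cdiff (psum c) w (psum (dcoef c) w).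
Proof.
move=> bc wr; have w0 := cmod_ge0 w.
(* Radii |w| < t < t1 < t2 < t3 < rho: the ratios t / t1 and t1 / t2 each absorb one of the two
   factors k of [taylor_power], and t2 / t3 leaves a geometric series. *)
have [t3 wt3 t3r] := real_between wr.
have [t2 wt2 t23] := real_between wt3.
have [t1 wt1 t12] := real_between wt2.
have [t wt tt1] := real_between wt1.
have [t0 [t10 [t20 t30]]] : 0 < t /\ 0 < t1 /\ 0 < t2 /\ 0 < t3 by do !split; lra.
pose d := t - cmod w; have d0 : 0 < d by rewrite /d; lra.
have [|M M0 HM] := bc t3; first by rewrite t30.
have q1 : 0 <= t / t1 < 1 by rewrite divr_ge0 ?ltr_pdivrMr ?mul1r ?tt1 ?ltW.
have q2 : 0 <= t1 / t2 < 1 by rewrite divr_ge0 ?ltr_pdivrMr ?mul1r ?t12 ?ltW.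
have q3 : 0 <= t2 / t3 < 1 by rewrite divr_ge0 ?ltr_pdivrMr ?mul1r ?t23 ?ltW.
pose A := M * ((1 - t / t1)^-1 * (1 - t1 / t2)^-1).
have A0 : 0 <= A by rewrite !mulr_ge0// invr_ge0; lra.
have coef k : cmod (c k) * (k%:R ^+ 2 * t ^+ k) <= A * (t2 / t3) ^+ k.
  have -> : cmod (c k) * (k%:R ^+ 2 * t ^+ k) = cmod (c k) * t3 ^+ k *
      ((k%:R * (t / t1) ^+ k) * (k%:R * (t1 / t2) ^+ k)) * (t2 / t3) ^+ k.
    by rewrite !expr_div_n; field; rewrite !expf_neq0// gt_eqF.
  have ge0 (x y : R) : 0 < x -> 0 < y -> 0 <= k%:R * (x / y) ^+ k.
    by move=> x0 y0; rewrite mulr_ge0 ?ler0n// exprn_ge0// divr_ge0// ltW.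
  apply: ler_wpM2r; first by rewrite exprn_ge0//; case/andP: q3.
  rewrite /A; apply: ler_pM => //.
  - by rewrite mulr_ge0 ?cmod_ge0// exprn_ge0// ltW.
  - by rewrite mulr_ge0 ?ge0.
  - by apply: ler_pM; rewrite ?ge0// nat_geometric.
pose K := A / t ^+ 2 / (1 - t2 / t3).
have K0 : 0 <= K by rewrite /K !divr_ge0// ?exprn_ge0 ?(ltW t0)//; lra.
have key v : cmod (v - w) < d ->
    cmod (psum c v - psum c w - psum (dcoef c) w * (v - w)) <= K * cmod (v - w) ^+ 2.
  move=> vw.
  have vt : cmod v <= t by have := cmodD (v - w) w; move: vw; rewrite subrK /d; lra.
  have sv : csums (fun k => c k * v ^+ k) (psum c v) by apply: (psumP bc); lra.
  have sw := psumP bc wr; have sd := psumP (bounded_dcoef bc) wr.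
  have {}sd : csums (fun k => k%:R * c k * w ^+ k.-1) (psum (dcoef c) w).
    by have := @csums_recl R (fun k => k%:R * c k * w ^+ k.-1) _ sd; rewrite !mul0r add0r.
  have tay k := ler_wpM2l (cmod_ge0 (c k)) (taylor_power k vt (ltW wt) t0).
  have h20 : 0 <= cmod (v - w) ^+ 2 by rewrite exprn_ge0 ?cmod_ge0.
  have := csumsD (csumsD sv (csumsM (-1) sw)) (csumsM (- (v - w)) sd).
  move: (psum c v) (psum c w) (psum (dcoef c) w) => a b a' H.
  have E : a + -1 * b + - (v - w) * a' = a - b - a' * (v - w) by ring.
  rewrite E in H.
  have EK : K * cmod (v - w) ^+ 2 = cmod (v - w) ^+ 2 * A / t ^+ 2 / (1 - t2 / t3).
    by rewrite /K; ring.
  rewrite EK; apply: (csums_le q3 _ H) => k.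
  have -> : c k * v ^+ k + -1 * (c k * w ^+ k) + - (v - w) * (k%:R * c k * w ^+ k.-1) =
     c k * (v ^+ k - w ^+ k - (v - w) * (k%:R * w ^+ k.-1)) by ring.
  rewrite cmodM [leRHS]mulrAC ler_pdivlMr ?exprn_gt0// -mulrA.
  apply: le_trans (tay k) _; rewrite (mulrCA (cmod (c k))) -(mulrA _ A); exact: ler_wpM2l.
move=> e e0; exists (Num.min d (e / (K + 1))).
  by rewrite lt_min d0 divr_gt0//; lra.
move=> v; rewrite lt_min => /andP[/key kv].
rewrite ltr_pdivlMr; last by lra.
move=> ve; apply: le_trans kv _; have := cmod_ge0 (v - w).
set X := cmod _ in ve * => X0; nra.
Qed.

Lemma bounded_iter_dcoef c rho j : bounded_coef c rho -> bounded_coef (iter j dcoef c) rho.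
Proof. by move=> bc; elim: j => //= j; exact: bounded_dcoef. Qed.

Lemma iter_dcoefE c j k : k`!%:R * iter j dcoef c k = (k + j)`!%:R * c (k + j)%N.
Proof.
elim: j k => [|j IH] k /=; first by rewrite addn0.
by rewrite /dcoef mulrA -natrM mulnC -factS IH addSnnS.
Qed.

Lemma iter_dcoef_at0 c j : iter j dcoef c 0%N = j`!%:R * c j.
Proof. by have := iter_dcoefE c j 0; rewrite fact0 mul1r add0n. Qed.

Lemma near_cdiff (f g : C -> C) (w d : C) :
  (\forall v \near w, f v = g v) -> cdiff f w d -> cdiff g w d.
Proof.
move=> fg fd e /fd[r r0 Hr]; move: (fg) => /cnbhsP[t t0 Ht].
exists (Num.min r t); first by rewrite lt_min r0.
move=> v; rewrite lt_min => /andP[vr vt].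
by rewrite -(Ht v vt) -(Ht w) ?subrr ?cmod0//; exact: Hr.
Qed.

Lemma eq_derive1n (W : set C) (f g : C -> C) : open W -> (forall z, W z -> f z = g z) ->
  forall k z, W z -> derive1n k f z = derive1n k g z.
Proof.
move=> oW fg k; elim: k => [//|k IH] z Wz.
rewrite !derive1nS !derive1E; apply: near_eq_derive.
have : nbhs z W by exact: open_nbhs_nbhs.
by apply: filterS => v /IH.
Qed.

Lemma derive1n_psum c rho j w : bounded_coef c rho -> cmod w < rho ->
  derive1n j (psum c) w = psum (iter j dcoef c) w.
Proof.
move=> bc; elim: j w => [//|j IH] w wr.
rewrite derive1nS; apply: cdiff_derive1.
apply: (near_cdiff (f := psum (iter j dcoef c))); last first.
  exact: psum_cdiff (bounded_iter_dcoef _ bc) wr.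
apply/cnbhsP; exists (rho - cmod w); first by rewrite subr_gt0.
by move=> v vw; rewrite IH//; have := cmodD (v - w) w; rewrite subrK; lra.
Qed.

Lemma derive1n_psum_cdiff c rho j w : bounded_coef c rho -> cmod w < rho ->
  derivable (derive1n j (psum c)) w 1.
Proof.
move=> bc wr; apply: (@cdiff_derivable _ _ _ (psum (iter j.+1 dcoef c) w)).
apply: (near_cdiff (f := psum (iter j dcoef c))); last first.
  exact: psum_cdiff (bounded_iter_dcoef _ bc) wr.
apply/cnbhsP; exists (rho - cmod w); first by rewrite subr_gt0.
move=> v vw; rewrite (derive1n_psum _ bc)//.
by have := cmodD (v - w) w; rewrite subrK; lra.
Qed.

Lemma derive1n_psum_at0 c rho j : 0 < rho -> bounded_coef c rho ->
  derive1n j (psum c) 0 = j`!%:R * c j.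
Proof.
by move=> r0 bc; rewrite (derive1n_psum _ bc) ?cmod0// psum_at0 iter_dcoef_at0.
Qed.

End PowerSeries.

(** * Taylor expansions of holomorphic functions *)

Section Taylor.
Context {R : realType}.
Local Notation C := (Cplx R).
Implicit Types (f g : C -> C) (a : C) (W : set C).

Lemma derive1_shift f a z : derive1 (fun w => f (w + a)) z = derive1 f (z + a).
Proof.
rewrite /derive1; set u := (fun _ => _); set v := (fun _ => _).
by suff -> : u = v by []; apply/funext => h; rewrite /u /v addrA.
Qed.

Lemma derive1n_shift f a k :
  derive1n k (fun z => f (z + a)) = (fun z => derive1n k f (z + a)).
Proof.
by elim: k => [//|k IH]; rewrite !derive1nS IH; apply/funext => z; exact: derive1_shift.
Qed.

Lemma cdiff_shift f a z d : cdiff f (z + a) d -> cdiff (fun w => f (w + a)) z d.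
Proof.
move=> fd e /fd[r r0 Hr]; exists r => // w wz.
have E : w + a - (z + a) = w - z by ring.
by have := Hr (w + a); rewrite E => /(_ wz).
Qed.

Definition tcoef f a : nat -> C := fun k => derive1n k f a / k`!%:R.

Lemma fact_neq0 k : k`!%:R != 0 :> C.
Proof. by rewrite pnatr_eq0 -lt0n fact_gt0. Qed.

(** Cauchy's expansion translated from 0 to [a]; termwise differentiation of its sum identifies the
    coefficients. The condition 2 * s < r puts the square of half-side [s] inside the disc. The
    first clause is Cauchy's estimate. *)
Lemma holo_taylor f a (r s : R) : 0 < s -> 2 * s < r ->
  (forall z, cmod (z - a) < r -> derivable f z 1) ->
  [/\ forall M, (forall z, cmod (z - a) < r -> cmod (f z) <= M) ->
        forall k, cmod (tcoef f a k) * s ^+ k <= 4 * M,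
      exists2 M : R, 0 <= M & forall k, cmod (tcoef f a k) * s ^+ k <= M,
      bounded_coef (tcoef f a) s
    & forall z, cmod (z - a) < s -> f z = psum (tcoef f a) (z - a)].
Proof.
move=> s0 sr fd; pose F z := f (z + a).
have Fd z : cmod z < r -> derivable F z 1.
  move=> zr; apply: cdiff_derivable; apply: cdiff_shift; apply: derivable_cdiff.
  by apply: fd; rewrite addrK.
have [c [cF cM]] := cauchy_series s0 sr Fd.
have [M M0 HM] : exists2 M : R, 0 <= M & forall k, cmod (c k) * s ^+ k <= M.
  have [|M M0 HM] := compact_cmod_bounded (f := F \o clamp s) (@compact_square R s).
    apply: continuous_subspaceT => z; apply: continuous_comp; first exact: clamp_continuous.
    apply/cdiff_cont/derivable_cdiff/Fd.
    by have := square_cmod (clamp_in z (ltW s0)); lra.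
  exists (4 * M); first by lra.
  by apply: cM => z sz; have := HM z sz; rewrite /= clamp_id.
have bc : bounded_coef c s.
  move=> t /andP[t0 ts]; exists M => // k; apply: le_trans (HM k).
  by rewrite ler_wpM2l ?cmod_ge0//; apply: lerXn2r; rewrite ?nnegrE; lra.
have FE z : cmod z < s -> F z = psum c z.
  move=> zs; apply/esym/psum_eq => e e0.
  have [K [q [q01 H]]] := cF z zs; have [N0 H0] := geometric_small K q01 e0.
  exists N0.+1 => -[//|N]; rewrite ltnS => /H0; exact: le_trans (H N).
have cE : c = tcoef f a.
  apply/funext => k; rewrite /tcoef.
  have -> : derive1n k f a = derive1n k F 0 by rewrite derive1n_shift add0r.
  rewrite (@eq_derive1n _ (disc 0 s) F (psum c)) ?(derive1n_psum_at0 _ s0 bc).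
  - by rewrite mulrC mulKf// fact_neq0.
  - exact: disc_open.
  - by move=> z; rewrite discE /= subr0 => /FE.
  - by rewrite discE /= subrr cmod0.
rewrite -cE; split=> //; last first.
- by move=> z /FE <-; rewrite /F subrK.
- by exists M.
- move=> M' HM' k; apply: cM => z sz; apply: HM'; rewrite addrK.
  by have := square_cmod sz; lra.
Qed.

Lemma open_disc W z : open W -> W z ->
  exists2 r : R, 0 < r & forall w, cmod (w - z) < r -> W w.
Proof.
move=> /copenP oW /oW[r r0 rW]; exists r => // w wz.
by apply: rW; rewrite discE.
Qed.

(** Near [z] the function is the sum of a power series, which is infinitely differentiable. *)
Lemma holo_derive1n W f k z : open W -> (forall z, W z -> derivable f z 1) ->
  W z -> derivable (derive1n k f) z 1.
Proof.
move=> oW fd Wz; have [r r0 rW] := open_disc oW Wz.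
have s0 : 0 < r / 3 by lra.
have [|w wz|_ _ bc fE] := @holo_taylor f z r (r / 3) s0.
- by lra.
- exact/fd/rW.
apply: cdiff_derivable.
apply: (near_cdiff (f := derive1n k (fun w => psum (tcoef f z) (w - z)))); last first.
  rewrite derive1n_shift; apply: (@cdiff_shift _ (- z)); apply: derivable_cdiff; rewrite subrr.
  by apply: (@derive1n_psum_cdiff R _ _ k 0 bc); rewrite cmod0.
apply/cnbhsP; exists (r / 3) => // w wz.
apply: (@eq_derive1n _ (disc z (r / 3))); first exact: disc_open.
  by move=> v; rewrite discE /= => /fE ->.
by rewrite discE.
Qed.

Lemma derive1n_add i j f : derive1n i (derive1n j f) = derive1n (i + j) f.
Proof. by rewrite /derive1n iterD. Qed.

Lemma derive1n_cst0 k : derive1n k (fun _ : C => 0 : C) = fun=> 0.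
Proof.
elim: k => [//|k IH]; rewrite derive1nS IH; apply/funext => z.
exact: (@derive1_cst C C 0).
Qed.

Lemma derive1n_lin W f g (t : C) k z : open W ->
  (forall z, W z -> derivable f z 1) -> (forall z, W z -> derivable g z 1) ->
  W z -> derive1n k (fun w => f w + t * g w) z = derive1n k f z + t * derive1n k g z.
Proof.
move=> oW fd gd; elim: k z => [//|k IH] z Wz.
have cf := derivable_cdiff (@holo_derive1n W f k z oW fd Wz).
have cg := derivable_cdiff (@holo_derive1n W g k z oW gd Wz).
apply: (@cdiff_derive1 R (derive1n k (fun w => f w + t * g w))).
apply: (near_cdiff (f := fun w => derive1n k f w + t * derive1n k g w)).
  have : nbhs z W by exact: open_nbhs_nbhs.
  by apply: filterS => v /IH.
move=> e e0; have K0 : 0 < cmod t + 1 by have := cmod_ge0 t; lra.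
have e2 : 0 < e / 2 by lra.
have [r1 r10 H1] := cf _ e2; have [r2 r20 H2] := cg _ (divr_gt0 e2 K0).
exists (Num.min r1 r2); first by rewrite lt_min r10.
move=> w; rewrite lt_min => /andP[/H1 h1 /H2 h2].
have alg (x y x' y' u v d : C) : x + t * y - (x' + t * y') - (u + t * v) * d =
  (x - x' - u * d) + t * (y - y' - v * d) by ring.
rewrite alg; move: (_ - _ - _) (_ - derive1n k g z - _) h1 h2 => A B h1 h2.
apply: le_trans (cmodD _ _) _; rewrite cmodM.
have n0 := cmod_ge0 (w - z); have B0 := cmod_ge0 B.
have : (cmod t + 1) * cmod B <= e / 2 * cmod (w - z).
  have := ler_wpM2l (ltW K0) h2; move/le_trans; apply.
  by rewrite mulrA mulrCA divff ?mulr1// gt_eqF.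
by nra.
Qed.

End Taylor.

(** * Extendability and Taylor coefficients *)

Section Extension.
Context {R : realType}.
Local Notation C := (Cplx R).
Implicit Types (f g : C -> C) (W V : set C).

(** The bound is a natural number so that the conditions form a countable family. *)
Definition bounded_at f (a : C) (rho : R) (M : nat) :=
  forall k, cmod (tcoef f a k) * rho ^+ k <= M%:R.

Definition ratC (p q : rat) : C := (ratr p)%:C + 'i * (ratr q)%:C.

Lemma ratC_dense (z : C) (e : R) : 0 < e -> exists p q, cmod (ratC p q - z) < e.
Proof.
move=> e0.
have rat_near (x : R) : exists p : rat, `|ratr p - x| < e / 2.
  have [|p] := @rat_in_itvoo R (x - e / 2) (x + e / 2); first by lra.
  rewrite in_itv /= => /andP[p1 p2]; exists p.
  by rewrite ltr_norml; lra.
have [p Hp] := rat_near (Re z); have [q Hq] := rat_near (Im z).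
exists p, q; apply: le_lt_trans (cmod_le_ReIm _) _.
have [rE iE] := ReIm_mk (ratr p : R) (ratr q).
by rewrite ReD ImD ReN ImN /ratC rE iE; lra.
Qed.

(** The supremum of the parameters sent into [V] gives a limit of points of [V]; were it in [V],
    openness would allow a larger parameter. *)
Lemma segment_boundary V (v p : C) : open V -> V v -> ~ V p ->
  exists2 t : R, 0 <= t <= 1 & ~ V (v + t%:C * (p - v)) /\
    forall e : R, 0 < e -> exists2 w, V w & cmod (w - (v + t%:C * (p - v))) < e.
Proof.
move=> oV Vv nVp; pose l (t : R) : C := v + t%:C * (p - v).
pose S := [set t : R | 0 <= t <= 1 /\ V (l t)].
have l0 : l 0 = v by rewrite /l mul0r addr0.
have l1 : l 1 = p by rewrite /l mul1r addrC subrK.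
have S0 : S 0 by split; [rewrite lexx ler01|rewrite l0].
have hs : has_sup S by split; [exists 0|exists 1 => x [/andP[]]].
have s0 : 0 <= sup S by apply: ub_le_sup; [exact: hs.2|].
have s1 : sup S <= 1 by apply: ge_sup; [exact: hs.1|move=> x [/andP[]]].
have lE s t : cmod (l s - l t) = `|s - t| * cmod (p - v).
  by rewrite -cmod_real -cmodM /l rmorphB /=; congr cmod; ring.
pose K := cmod (p - v) + 1.
have K0 : 0 < K by have := cmod_ge0 (p - v); rewrite /K; lra.
have lK s t e : `|s - t| < e / K -> cmod (l s - l t) < e.
  rewrite lE ltr_pdivlMr//; apply: le_lt_trans.
  by rewrite ler_wpM2l ?normr_ge0// /K; lra.
exists (sup S); first by rewrite s0.
split=> [Vs|e e0].
- have [r r0 rV] := open_disc oV Vs.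
  have sN1 : sup S != 1 by apply/eqP => sE; apply: nVp; rewrite -l1 -sE.
  have s1' : sup S < 1 by rewrite lt_neqAle sN1.
  pose d := Num.min ((1 - sup S) / 2) (r / K / 2).
  have rK0 : 0 < r / K by exact: divr_gt0.
  have d0 : 0 < d by rewrite /d lt_min; apply/andP; split; lra.
  have [d1 d2] : d <= (1 - sup S) / 2 /\ d <= r / K / 2.
    by split; rewrite /d ge_min lexx ?orbT.
  have : S (sup S + d).
    split; first by lra.
    by apply: rV; apply: lK; rewrite addrC addKr gtr0_norm//; lra.
  by move/(ub_le_sup hs.2); lra.
- have [t [t01 Vt] tS] := sup_adherent (divr_gt0 e0 K0) hs.
  exists (l t) => //; apply: lK.
  have tS' : t <= sup S by apply: ub_le_sup; [exact: hs.2|].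
  by rewrite distrC ger0_norm; lra.
Qed.

Lemma disc_segment (c v p : C) (r t : R) : 0 <= t <= 1 ->
  disc c r v -> disc c r p -> disc c r (v + t%:C * (p - v)).
Proof.
rewrite !discE /= => /andP[t0 t1] vr pr.
have -> : v + t%:C * (p - v) - c = (1 - t)%:C * (v - c) + t%:C * (p - c).
  by rewrite rmorphB /=; ring.
apply: le_lt_trans (cmodD _ _) _; rewrite !cmodM !cmod_real.
rewrite (ger0_norm t0) ger0_norm; last by lra.
have := cmod_ge0 (v - c); have := cmod_ge0 (p - c).
have [->|tN0] := eqVneq t 0; first by lra.
have {tN0}t0' : 0 < t by rewrite lt_def tN0.
by nra.
Qed.

Lemma extendable_of_bounded W f a (rho : R) M : open W -> holomorphic W f -> W a ->
  0 < rho -> disc a rho `&` ~` W !=set0 -> bounded_at f a rho M -> extendable W f.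
Proof.
move=> oW fd Wa rho0 nW bf.
have [r r0 rW] := open_disc oW Wa.
pose s := r / 3; have s0 : 0 < s by rewrite /s; lra.
have [||_ _ bs fE] := @holo_taylor R f a r s s0; first by rewrite /s; lra.
  by move=> z /rW /fd.
have br : bounded_coef (tcoef f a) rho.
  move=> t /andP[t0 tr]; exists M%:R => [|k]; first exact: ler0n.
  apply: le_trans (bf k); rewrite ler_wpM2l ?cmod_ge0//.
  by apply: lerXn2r; rewrite ?nnegrE; lra.
(* Halving keeps the closed disc inside both [disc a rho] and the disc where [f] equals its Taylor
   sum. *)
pose r1 := Num.min s rho / 2.
have [r1s r1r] : r1 <= s / 2 /\ r1 <= rho / 2.
  by rewrite /r1; split; rewrite ler_pM2r ?invr_gt0// ge_min lexx ?orbT.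
have r10 : 0 < r1 by rewrite /r1 divr_gt0// lt_min s0.
exists a, r1, a, rho; split => //.
- by split => //; exists a; split => //; rewrite discE /= subrr cmod0.
- have cl : closed [set z : C | cmod (z - a) <= r1].
    apply: (@closed_comp _ _ (fun z : C => z - a) [set z | cmod z <= r1]).
      by move=> z _; exact: cvgB cvg_id (cvg_cst _).
    exact: closed_cmod_le.
  have sub : closure (disc a r1) `<=` [set z : C | cmod (z - a) <= r1].
    rewrite [X in _ `<=` X](closure_id _).1//; apply: closureS.
    by move=> z; rewrite discE /= => /ltW.
  move=> z /sub /= za; split; first by rewrite discE /=; lra.
  by apply: rW; rewrite /s in r1s; lra.
- exists (fun z => psum (tcoef f a) (z - a)); split.
    move=> z; rewrite discE /= => za.
    apply: cdiff_derivable; apply: (@cdiff_shift _ (psum (tcoef f a)) (- a)).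
    exact: psum_cdiff br za.
  by move=> z; rewrite discE /= => za; rewrite fE//; lra.
Qed.

Lemma tcoef_eq W f g a : open W -> (forall z, W z -> f z = g z) -> W a ->
  tcoef f a = tcoef g a.
Proof. by move=> oW fg Wa; apply/funext => k; rewrite /tcoef (eq_derive1n oW fg). Qed.

Lemma bounded_of_extendable W f : open W -> holomorphic W f -> extendable W f ->
  exists p q (rho : rat) M, [/\ W (ratC p q), 0 < ratr rho :> R,
    disc (ratC p q) (ratr rho) `&` ~` W !=set0 & bounded_at f (ratC p q) (ratr rho) M].
Proof.
move=> oW fd [c1 [r1 [c2 [r2 [r10 r20 [_ [p [D2p nWp]]] c1r1 [g [gd gf]]]]]]].
have D2W z : disc c1 r1 z -> disc c2 r2 z /\ W z.
  by move=> /(@subset_closure _ _ z)/c1r1.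
(* Asking for a whole neighbourhood makes [V] open. The segment from [c1], in [V], to [p], outside
   [W], then meets the boundary of [V] at a point [b], which is in the disc by convexity. *)
pose V := [set w : C | exists2 e : R, 0 < e &
  forall u, cmod (u - w) < e -> [/\ disc c2 r2 u, W u & g u = f u]].
have oV : open V.
  apply/copenP => w [e e0 He]; exists (e / 2); first by lra.
  move=> w'; rewrite discE /= => ww; exists (e / 2); first by lra.
  move=> u uw; apply: He.
  have -> : u - w = (u - w') + (w' - w) by ring.
  by apply: le_lt_trans (cmodD _ _) _; lra.
have Vc1 : V c1.
  exists r1 => // u uc; have D1u : disc c1 r1 u by rewrite discE.
  by have [? ?] := D2W _ D1u; split => //; exact: gf.
have nVp : ~ V p by move=> [e e0 /(_ p)]; rewrite subrr cmod0 => /(_ e0)[].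
have [t t01 [nVb clb]] := segment_boundary oV Vc1 nVp.
set b := c1 + _ in nVb clb.
have D2b : disc c2 r2 b.
  apply: disc_segment => //; apply: (D2W c1 _).1.
  by rewrite discE /= subrr cmod0.
have [e e0 be] := open_disc (@disc_open R c2 r2) D2b.
have nWb : ~ W b.
  (* The derivatives of f - g vanish on [V], hence at its limit point [b] by continuity; the Taylor
     expansion at [b] then makes f - g vanish near [b], which puts [b] in [V]. *)
  move=> Wb; apply: nVb.
  have [e' e'0 be'] := open_disc oW Wb.
  pose d := Num.min e e'; have d0 : 0 < d by rewrite lt_min e0.
  have inD u : cmod (u - b) < d -> disc c2 r2 u /\ W u.
    by rewrite lt_min => /andP[/be ? /be' ?].
  pose h := fun z => f z + (-1) * g z.
  have hd z : cmod (z - b) < d -> derivable h z 1.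
    move=> /inD[zD zW]; apply: derivableD; first exact: fd.
    by apply: derivableM; [exact: derivable_cst|exact: gd].
  have hV w : V w -> forall k, derive1n k h w = 0.
    move=> [d' d'0 Hw] k.
    rewrite (@eq_derive1n _ (disc w d') h (fun=> 0)).
    - by rewrite derive1n_cst0.
    - exact: disc_open.
    - by move=> z; rewrite discE /= => /Hw[_ _ gfz]; rewrite /h gfz mulN1r subrr.
    - by rewrite discE /= subrr cmod0.
  have hb k : derive1n k h b = 0.
    apply/eqP; rewrite -cmod_eq0 eq_le cmod_ge0 andbT.
    apply/ler_addgt0Pl => x x0; rewrite addr0.
    have hdD z : disc b d z -> derivable h z 1 by rewrite discE; exact: hd.
    have bb : disc b d b by rewrite discE /= subrr cmod0.
    have := @holo_derive1n R _ h k b (@disc_open R b d) hdD bb.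
    move=> /derivable_cdiff/cdiff_cont/ccontP/(_ _ x0)/cnbhsP[y y0 Hy].
    have [w Vw /Hy] := clb _ y0.
    by rewrite (hV _ Vw) sub0r cmodN => /ltW.
  have d30 : 0 < d / 3 by lra.
  have [|z zb|_ _ _ hE] := @holo_taylor R h b d (d / 3) d30.
  - by lra.
  - exact: hd.
  exists (d / 3) => // u ub.
  have [|uD uW] := inD u; first by lra.
  split => //; have := hE u ub.
  have -> : tcoef h b = fun=> 0 by apply/funext => k; rewrite /tcoef hb mul0r.
  rewrite (@psum_eq _ _ _ 0); first by rewrite /h mulN1r => /eqP; rewrite subr_eq0 => /eqP ->.
  by move=> x x0; exists 0%N => N _; rewrite big1 ?subrr ?cmod0 ?ltW// => i _; rewrite mul0r.
(* The centre a is within eps of [b] and rho is between eps and 2 * eps, so D(a, rho) contains [b].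
   Taylor's bound at radius 4 * eps uses [g] on D(a, 9 * eps), contained in D(b, 10 * eps), and 10 *
   eps = e. *)
pose eps := e / 10; have eps0 : 0 < eps by rewrite /eps; lra.
have [v Vv vb] := clb _ eps0.
have [d d0 dV] := open_disc oV Vv.
(* The first bound keeps a in [V], where f and g share their Taylor coefficients; the second keeps
   it within eps of [b]. *)
pose dd := Num.min d (eps - cmod (v - b)).
have dd0 : 0 < dd by rewrite lt_min d0 subr_gt0.
have [p1 [q1]] := ratC_dense v dd0; rewrite lt_min => /andP[ad ae].
set a := ratC p1 q1 in ad ae *.
have ab : cmod (a - b) < eps.
  have -> : a - b = (a - v) + (v - b) by ring.
  by apply: le_lt_trans (cmodD _ _) _; lra.
have [x x0 Hx] := dV _ ad.
have [|rho] := @rat_in_itvoo R eps (2 * eps); first by lra.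
rewrite in_itv /= => /andP[rho1 rho2].
have [_ Wa _] := Hx a ltac:(by rewrite subrr cmod0).
have a0 : 0 < 4 * eps by lra.
have [|z za|_ [M M0 HM] _ _] := @holo_taylor R g a (9 * eps) (4 * eps) a0.
- by lra.
- apply: gd; apply: be.
  have -> : z - b = (z - a) + (a - b) by ring.
  by apply: le_lt_trans (cmodD _ _) _; rewrite /eps in za ab *; lra.
exists p1, q1, rho, (Num.truncn M).+1; split => //.
- by lra.
- by exists b; split => //; rewrite discE /= cmodBC; lra.
- move=> k; rewrite -/a (@tcoef_eq (disc a x) f g a).
  + apply: (@le_trans _ _ M); last by apply/ltW; rewrite truncnS_gt.
    apply: le_trans (HM k); rewrite ler_wpM2l ?cmod_ge0//.
    by apply: lerXn2r; rewrite ?nnegrE; lra.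
  + exact: disc_open.
  + by move=> z; rewrite discE /= => /Hx[].
  + by rewrite discE /= subrr cmod0.
Qed.

End Extension.

(** * The space A_F and its topology *)

Section AFSpace.
Context {R : realType}.
Local Notation C := (Cplx R).
Variables (W : set C) (F : set nat) (I : set nat) (Om : nat -> set C) (zpt : nat -> C).
Hypotheses (oW : open W) (compz : component_points W I Om zpt).
Implicit Types (f g : C -> C).
Local Notation lin f t g := (fun w : C => f w + t * g w).

Lemma AF_holo f : AF W F f -> forall z, W z -> derivable f z 1.
Proof. by case. Qed.

Lemma holo_lin f g (t : C) : holomorphic W f -> holomorphic W g -> holomorphic W (lin f t g).
Proof.
move=> fd gd z Wz; apply: derivableD; first exact: fd.
by apply: derivableM; [exact: derivable_cst|exact: gd].
Qed.

Lemma within_lin (A : set C) f g (t : C) : {within A, continuous f} ->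
  {within A, continuous g} -> {within A, continuous (lin f t g)}.
Proof.
move=> fc gc; apply: (@ccontD R (subspace A) f (fun w => t * g w) fc).
exact: (ccontM (@ccont_cst R (subspace A) t) gc).
Qed.

Lemma cont_extension_lin l f g (t : C) e1 e2 : holomorphic W f -> holomorphic W g ->
  cont_extension W (derive1n l f) e1 -> cont_extension W (derive1n l g) e2 ->
  cont_extension W (derive1n l (lin f t g)) (lin e1 t e2).
Proof.
move=> fd gd [c1 h1] [c2 h2]; split; first exact: (@within_lin (closure W) e1 e2 t c1 c2).
by move=> z Wz; rewrite h1// h2// (derive1n_lin _ _ oW fd gd Wz).
Qed.

Lemma AF_lin f g (t : C) : AF W F f -> AF W F g -> AF W F (lin f t g).
Proof.
move=> [fd fF f0] [gd gF g0]; split.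
- exact: holo_lin.
- move=> l Fl; have [fl [e1 he1]] := fF _ Fl; have [gl [e2 he2]] := gF _ Fl.
  split; last by exists (lin e1 t e2); exact: cont_extension_lin.
  by move=> z Wz; exact: (@holo_derive1n R W (lin f t g) l z oW (@holo_lin f g t fd gd) Wz).
- by move=> z nWz; rewrite f0// g0// mulr0 addr0.
Qed.

Lemma cont_extension_unique f e1 e2 : cont_extension W f e1 -> cont_extension W f e2 ->
  forall w, closure W w -> e1 w = e2 w.
Proof.
move=> [c1 h1] [c2 h2] w cw; apply/eqP; rewrite -subr_eq0 -cmod_eq0 eq_le cmod_ge0 andbT.
apply/ler_addgt0Pl => x x0; rewrite addr0; have x2 : 0 < x / 2 by lra.
have close (e : C -> C) : {within closure W, continuous e} ->
    exists2 d : R, 0 < d & forall u, cmod (u - w) < d -> W u -> cmod (e u - e w) < x / 2.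
  move=> /(_ w)/ccontP/(_ _ x2) H.
  have : within (closure W) (nbhs w) [set u | cmod (e u - e w) < x / 2].
    by rewrite (nbhs_subspace_in cw); exact: H.
  rewrite /within /= => /cnbhsP[d d0 Hd]; exists d => // u uw Wu.
  exact/Hd/subset_closure.
have [d1 d10 H1] := close _ c1; have [d2 d20 H2] := close _ c2.
have : nbhs w [set u | cmod (u - w) < Num.min d1 d2].
  by apply/cnbhsP; exists (Num.min d1 d2) => //; rewrite lt_min d10.
move=> /cw[u [Wu]]; rewrite /= lt_min => /andP[/H1/(_ Wu) u1 /H2/(_ Wu)].
rewrite h1// h2// in u1 * => u2.
have -> : e1 w - e2 w = (f u - e2 w) - (f u - e1 w) by ring.
by apply: le_trans (cmodB _ _) _; lra.
Qed.

Lemma extP f : (exists g, cont_extension W f g) -> cont_extension W f (ext W f).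
Proof. exact: (@xgetPex _ (fun=> 0) [set g | cont_extension W f g]). Qed.

Lemma AF_ext f l : AF W F f -> F l -> cont_extension W (derive1n l f) (ext W (derive1n l f)).
Proof. by move=> [_ fF _] Fl; apply: extP; have [_] := fF _ Fl. Qed.

Lemma ext_lin f g (t : C) l w : AF W F f -> AF W F g -> F l -> closure W w ->
  ext W (derive1n l (lin f t g)) w = ext W (derive1n l f) w + t * ext W (derive1n l g) w.
Proof.
move=> Af Ag Fl; have e1 := AF_ext (AF_lin t Af Ag) Fl.
exact: (cont_extension_unique e1
  (cont_extension_lin t (AF_holo Af) (AF_holo Ag) (AF_ext Af Fl) (AF_ext Ag Fl))).
Qed.

Lemma closure_bounded_compact (a : R) : 0 <= a -> compact [set w : C | closure W w /\ cmod w <= a].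
Proof.
move=> a0; apply: (@subclosed_compact _ _ (@square R a)); last 2 first.
- exact: compact_square.
- move=> w [_ wa]; have := Re_le_cmod w; have := Im_le_cmod w.
  by rewrite /square /rect /= -!ler_norml => h1 h2; split; apply: le_trans wa.
- apply: closedI; [exact: closed_closure|exact: closed_cmod_le].
Qed.

(** [sup] is meaningful on bounded sets only; boundedness comes from continuity of the extension on
    a compact set. *)
Lemma sup_seminorm_ge l n f w : AF W F f -> F l -> closure W w -> cmod w <= n%:R ->
  cmod (ext W (derive1n l f) w) <= sup_seminorm W l n f.
Proof.
move=> Af Fl cw wn.
have [|M M0 HM] := compact_cmod_bounded (f := ext W (derive1n l f))
    (closure_bounded_compact (ler0n R n)).
  by apply: continuous_subspaceW (AF_ext Af Fl).1 => u [].
apply: ub_le_sup; last by exists w.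
by exists M => _ [u un <-]; exact: HM.
Qed.

Lemma sup_seminorm_le l n f (x : R) : 0 <= x ->
  (forall w, closure W w -> cmod w <= n%:R -> cmod (ext W (derive1n l f) w) <= x) ->
  sup_seminorm W l n f <= x.
Proof.
move=> x0 H; rewrite /sup_seminorm; set S := [set _ | _ in _].
(* The closure may miss the ball of radius [n]; [sup] is then 0 by convention, whence the hypothesis
   [0 <= x]. *)
have [->|/set0P S0] := eqVneq S set0; first by rewrite sup0.
by apply: ge_sup => // _ [w [cw wn] <-]; exact: H.
Qed.

Lemma sup_seminorm_ge0 l n f : AF W F f -> F l -> 0 <= sup_seminorm W l n f.
Proof.
move=> Af Fl; rewrite /sup_seminorm; set S := [set _ | _ in _].
have [->|/set0P[_ [w [cw wn] _]]] := eqVneq S set0; first by rewrite sup0.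
exact: le_trans (cmod_ge0 _) (sup_seminorm_ge Af Fl cw wn).
Qed.

Lemma zpt_in i : I i -> W (zpt i).
Proof.
move=> Ii; have [_ bij zP] := compz; have := zP _ Ii.
have [w Ww <-] : [set connected_component W w | w in W] (Om i).
  by have [fn _ _] := bij; exact: fn.
exact: connected_component_sub.
Qed.

Lemma AF_seminorm_lin p f g (t : C) : AF_seminorms W F I zpt p -> AF W F f -> AF W F g ->
  p (lin f t g) <= p f + cmod t * p g.
Proof.
move=> [[l [n [Fl _ ->]]]|[l [i [_ Ii ->]]]] Af Ag.
- apply: sup_seminorm_le => [|w cw wn].
    by rewrite addr_ge0 ?mulr_ge0 ?cmod_ge0 ?sup_seminorm_ge0.
  rewrite (ext_lin t Af Ag Fl cw); apply: le_trans (cmodD _ _) _.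
  rewrite cmodM; apply: lerD; first exact: sup_seminorm_ge.
  by rewrite ler_wpM2l ?cmod_ge0//; exact: sup_seminorm_ge.
- rewrite /point_seminorm (derive1n_lin _ _ oW (AF_holo Af) (AF_holo Ag) (zpt_in Ii)).
  by apply: le_trans (cmodD _ _) _; rewrite cmodM.
Qed.

Lemma AF_seminorm_ge0 p f : AF_seminorms W F I zpt p -> AF W F f -> 0 <= p f.
Proof.
by move=> [[l [n [Fl _ ->]]]|[l [i [_ Ii ->]]]] Af; [exact: sup_seminorm_ge0|exact: cmod_ge0].
Qed.

Lemma AF_seminorm0 p : AF_seminorms W F I zpt p -> p (fun=> 0) <= 0.
Proof.
move=> [[l [n [Fl _ ->]]]|[l [i [_ Ii ->]]]].
- apply: sup_seminorm_le => // w cw _.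
  have e0 : cont_extension W (derive1n l (fun=> 0)) (fun=> 0).
    by split; [exact: (continuous_subspaceT (@ccont_cst R C 0))|move=> z _; rewrite derive1n_cst0].
  by rewrite (cont_extension_unique (extP (ex_intro _ _ e0)) e0 cw) cmod0.
- by rewrite /point_seminorm derive1n_cst0 cmod0.
Qed.

Lemma subf_lin f g : f \- g = lin f (-1) g.
Proof. by apply/funext => w; rewrite mulN1r. Qed.

Lemma AF_sub f g : AF W F f -> AF W F g -> AF W F (f \- g).
Proof. by move=> Af Ag; rewrite subf_lin; exact: AF_lin. Qed.

End AFSpace.

Section AFTopology.
Context {R : realType}.
Local Notation C := (Cplx R).
Variables (W : set C) (F : set nat) (I : set nat) (Om : nat -> set C) (zpt : nat -> C).
Hypotheses (oW : open W) (compz : component_points W I Om zpt).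
Local Notation X := (AF_space W F I zpt).
Local Notation seminorm := (AF_seminorms W F I zpt).
Implicit Types (f g : X).

Lemma AF_val f : AF W F (set_val f).
Proof. exact: set_valP. Qed.

Lemma AF_ball_open p (h : C -> C) (e : R) : seminorm p -> AF W F h -> 0 < e ->
  open [set g : X | p (set_val g \- h) < e].
Proof.
move=> sp Ah e0; set B := [set g : X | _].
exists [set B]; last by rewrite bigcup_set1.
move=> _ ->; exists [fset (p, h, e)]%fset.
  by move=> x; rewrite in_fset1 => /eqP ->; apply/mem_set; split.
apply/seteqP; split=> [g /(_ (p, h, e))|g Bg x]; first by rewrite /= inE; apply.
by rewrite /= inE => /eqP ->.
Qed.

(** Unfolds the topology generated by the sub-base. The balls have arbitrary centres; all that is
    known of [g] is that it lies strictly inside each of them. *)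
Lemma AF_open_basis (O : set X) g : open O -> O g ->
  exists2 D : {fset ((C -> C) -> R) * (C -> C) * R},
    (forall x, x \in D -> [/\ seminorm x.1.1, AF W F x.1.2 & 0 < x.2]) &
    (forall x, x \in D -> x.1.1 (set_val g \- x.1.2) < x.2) /\
    forall h : X, (forall x, x \in D -> x.1.1 (set_val h \- x.1.2) < x.2) -> O h.
Proof.
move=> [B sB <-] [A BA Ag].
have [D sD DA] := sB _ BA; exists D.
  by move=> x /sD/set_mem.
split; first by move=> x xD; move: Ag; rewrite -DA => /(_ x xD).
move=> h Hh; have Ah : A h by rewrite -DA => x xD; exact: Hh.
by exists A.
Qed.

Lemma AF_ball_near p f (e : R) : seminorm p -> 0 < e ->
  \forall g \near f, p (set_val g \- set_val f) < e.
Proof.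
move=> sp e0; apply: open_nbhs_nbhs; split.
  exact: (AF_ball_open sp (AF_val f) e0).
have E : (set_val f \- set_val f) = (fun _ : C => 0 : C).
  by apply/funext => w; rewrite /= subrr.
by rewrite /= E; exact: le_lt_trans (AF_seminorm0 sp) e0.
Qed.

(** Continuity at [f] of the functional g |-> g^(l)(w). Its uniform version [near_small_on] is what
    the mean value inequality and Cauchy's estimates can use. *)
Definition near_small f l (w : C) := forall e : R, 0 < e ->
  \forall g \near f, cmod (derive1n l (set_val g \- set_val f) w) <= e.

Definition near_small_on f l (D : set C) := forall e : R, 0 < e ->
  \forall g \near f, forall w, D w -> cmod (derive1n l (set_val g \- set_val f) w) <= e.

Lemma near_small_inF f l w : F l -> W w ->
  exists2 r : R, 0 < r & disc w r `<=` W /\ near_small_on f l (disc w r).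
Proof.
move=> Fl Ww; have [r r0 rW] := open_disc oW Ww.
exists r => //; split=> [u|e e0]; first by rewrite discE => /rW.
pose n := (Num.truncn (cmod w + r)).+1.
have nP : cmod w + r < n%:R by rewrite truncnS_gt.
have sp : seminorm (sup_seminorm W l n) by left; exists l, n.
near=> g => u; rewrite discE /= => uw.
have Ad := AF_sub oW (AF_val g) (AF_val f).
have [_ he] := AF_ext Ad Fl.
have Wu := rW _ uw; have cu : closure W u by exact: subset_closure.
have un : cmod u <= n%:R by have := cmodD (u - w) w; rewrite subrK; lra.
rewrite -(he u Wu); apply: le_trans (sup_seminorm_ge Ad Fl cu un) _.
by apply: ltW; near: g; exact: AF_ball_near.
Unshelve. all: by end_near. Qed.

Lemma near_small_integrate f l w u (r : R) : disc w r `<=` W ->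
  near_small_on f l.+1 (disc w r) -> disc w r u -> near_small f l u ->
  near_small_on f l (disc w r).
Proof.
move=> rW Hd ur Hu e e0.
have r0 : 0 < r.
  by move: ur; rewrite discE /=; apply: le_lt_trans; exact: cmod_ge0.
have e2 : 0 < e / 2 by lra.
(* Points of the disc are at most 2 * r apart, so the mean value inequality, with its factor 2,
   contributes at most e / 2. *)
have e3 : 0 < e / (8 * r) by rewrite divr_gt0//; lra.
near=> g => v vr.
have Ad := AF_sub oW (AF_val g) (AF_val f).
have [h1 h2] : cmod (derive1n l (set_val g \- set_val f) u) <= e / 2 /\
    forall w', disc w r w' -> cmod (derive1n l.+1 (set_val g \- set_val f) w') <= e / (8 * r).
  by split; near: g; [exact: Hu|exact: Hd].
move: Ad h1 h2; set h := (set_val g \- set_val f) => Ad h1 h2.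
have mv : cmod (derive1n l h v - derive1n l h u) <= 2 * (e / (8 * r) * cmod (v - u)).
  apply: (mean_value_le (f' := derive1n l.+1 h)) => t t01.
    apply: derivable_cdiff; apply: (@holo_derive1n R W h l _ oW (AF_holo Ad)).
    exact/rW/disc_segment.
  exact/h2/disc_segment.
have vu : cmod (v - u) <= 2 * r.
  move: ur vr; rewrite !discE /= => ur vr.
  have -> : v - u = (v - w) - (u - w) by ring.
  by apply: le_trans (cmodB _ _) _; lra.
have := cmodD (derive1n l h v - derive1n l h u) (derive1n l h u); rewrite subrK.
have : e / (8 * r) * cmod (v - u) <= e / (8 * r) * (2 * r) by rewrite ler_wpM2l// ltW.
have -> : e / (8 * r) * (2 * r) = e / 4 by field; rewrite gt_eqF.
by lra.
Unshelve. all: by end_near. Qed.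

Lemma near_small_on_point f l (D : set C) w : D w -> near_small_on f l D -> near_small f l w.
Proof. by move=> Dw H e /H; apply: filterS => g; apply. Qed.

Lemma in_component w : W w -> exists2 i, I i & Om i = connected_component W w.
Proof.
move=> Ww; have [_ [_ _ sj] _] := compz.
have : [set connected_component W w | w in W] (connected_component W w) by exists w.
by move=> /sj[i Ii <-]; exists i.
Qed.

(* Where l < min F, smallness of the l-th derivative spreads from the base
   point over its whole component: the set of points where it holds is open
   and closed there by the mean value inequality. *)
Lemma near_small_below f l : (forall k, F k -> (l < k)%N) ->
  (forall w, W w -> exists2 r : R, 0 < r &
     disc w r `<=` W /\ near_small_on f l.+1 (disc w r)) ->
  forall w, W w -> exists2 r : R, 0 < r &
     disc w r `<=` W /\ near_small_on f l (disc w r).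
Proof.
move=> lF IH w Ww.
have spread w' u (r : R) : 0 < r -> disc w' r `<=` W -> near_small_on f l.+1 (disc w' r) ->
    disc w' r u -> near_small f l u -> forall v, disc w' r v -> near_small f l v.
  move=> r0 rW Hr ur Hu v vr.
  exact: near_small_on_point vr (near_small_integrate rW Hr ur Hu).
suff Pw : near_small f l w.
  have [r r0 [rW Hr]] := IH _ Ww; exists r => //; split => //.
  by apply: near_small_integrate Hr _ Pw => //; rewrite discE /= subrr cmod0.
have [i Ii OmE] := in_component Ww.
have Pz : near_small f l (zpt i).
  move=> e e0; have sp : seminorm (point_seminorm (zpt i) l) by right; exists l, i.
  by have := AF_ball_near f sp e0; apply: filterS => g /ltW.
have zA : connected_component W w (zpt i) by rewrite -OmE; have [_ _] := compz; apply.
have subW : connected_component W w `<=` W by exact: connected_component_sub.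
pose P := [set u | W u /\ near_small f l u].
pose Q := [set u | W u /\ ~ near_small f l u].
have center (u : C) (r : R) : 0 < r -> disc u r u by rewrite discE /= subrr cmod0.
have oP : open P.
  apply/copenP => u [Wu Pu]; have [r r0 [rW Hr]] := IH _ Wu; exists r => // v vr.
  by split; [exact: rW|exact: (spread u u r r0 rW Hr (center _ _ r0) Pu)].
have oQ : open Q.
  apply/copenP => u [Wu Pu]; have [r r0 [rW Hr]] := IH _ Wu; exists r => // v vr.
  split; first exact: rW.
  by move=> Pv; apply: Pu; exact: (spread u v r r0 rW Hr vr Pv u (center _ _ r0)).
have cA : connected (connected_component W w) by exact: component_connected.
have E : connected_component W w `&` P = connected_component W w.
  apply: cA.
  - by exists (zpt i); split => //; split => //; exact: subW.
  - by exists P.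
  (* Relative closedness: inside the component, [P] is the trace of the complement of the open set
     [Q]. *)
  - exists (~` Q); first by rewrite closedC.
    apply/seteqP; split=> u [Au].
      by move=> [_ Pu]; split => // -[_]; apply.
    move=> nQ; split => //; split; first exact: subW.
    by apply: contrapT => nP; apply: nQ; split => //; exact: subW.
have : connected_component W w w by exact: connected_component_refl.
by rewrite -E => -[_ []].
Qed.

Lemma near_small_all f k w : F !=set0 -> W w -> near_small f k w.
Proof.
move=> F0 Ww.
have exF : exists l, `[< F l >] by have [l Fl] := F0; exists l; apply/asboolP.
have [m /asboolP Fm mmin] := ex_minnP exF.
have ltF l : (l < m)%N -> forall k, F k -> (l < k)%N.
  by move=> lm k' Fk'; apply: leq_trans lm (mmin _ _); exact/asboolP.
(* Descends from the order m = min F, where the sup seminorms act, one integration at a time. *)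
have below j : (j <= m)%N -> forall w, W w -> exists2 r : R, 0 < r &
    disc w r `<=` W /\ near_small_on f (m - j) (disc w r).
  elim: j => [|j IH] jm w' Ww'; first by rewrite subn0; exact: near_small_inF.
  have mj : (m - j = (m - j.+1).+1)%N by lia.
  apply: near_small_below => //; first by apply: ltF; lia.
  by rewrite -mj; apply: IH; exact: ltnW.
have [km|mk] := leqP k m.
  have [|r r0 [rW Hr]] := below (m - k)%N _ w Ww; first by lia.
  rewrite subKn// in Hr; apply: near_small_on_point Hr.
  by rewrite discE /= subrr cmod0.
have [|r r0 [rW Hr]] := below 0%N _ w Ww; first by [].
rewrite subn0 in Hr => e e0.
pose s := r / 3; have s0 : 0 < s by rewrite /s; lra.
pose j := (k - m)%N.
(* The constant in Cauchy's estimate for the j-th derivative of h^(m): a bound e / K on h^(m) over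
   the disc yields e on h^(m + j) at [w]. *)
pose K := 4 * j`!%:R / s ^+ j : R.
have K0 : 0 < K by rewrite /K divr_gt0 ?exprn_gt0// mulr_gt0// ltr0n fact_gt0.
near=> g.
have Ad := AF_sub oW (AF_val g) (AF_val f).
have h2 : forall u, disc w r u -> cmod (derive1n m (set_val g \- set_val f) u) <= e / K.
  by near: g; apply: Hr; exact: divr_gt0.
move: Ad h2; set h := (set_val g \- set_val f) => Ad h2.
have [|u uw|bnd _ _ _] := @holo_taylor R (derive1n m h) w r s s0.
- by rewrite /s; lra.
- by apply: (@holo_derive1n R W h m u oW (AF_holo Ad)); apply: rW; rewrite discE.
have bh u : cmod (u - w) < r -> cmod (derive1n m h u) <= e / K.
  by move=> uw; apply: h2; rewrite discE.
have := bnd (e / K) bh j; rewrite /tcoef derive1n_add subnK ?(ltnW mk)//.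
rewrite cmodM cmodV cmod_nat.
have f0 : 0 < j`!%:R :> R by rewrite ltr0n fact_gt0.
have sj : 0 < s ^+ j by exact: exprn_gt0.
rewrite mulrAC ler_pdivrMr// -ler_pdivlMr// => /le_trans; apply.
by rewrite le_eqVlt /K; apply/orP; left; apply/eqP; field; rewrite !gt_eqF.
Unshelve. all: by end_near. Qed.

End AFTopology.

Section Nonextendable.
Context {R : realType}.
Local Notation C := (Cplx R).
Variables (W : set C) (F : set nat) (I : set nat) (Om : nat -> set C) (zpt : nat -> C).
Hypotheses (oW : open W) (F0 : F !=set0) (compz : component_points W I Om zpt).
Local Notation X := (AF_space W F I zpt).
Local Notation lin f t g := (fun w : C => f w + t * g w).

Definition crossing_disc (i : rat * rat * rat) :=
  [/\ W (ratC i.1.1 i.1.2), 0 < ratr i.2 :> R &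
      disc (ratC i.1.1 i.1.2) (ratr i.2) `&` ~` W !=set0].

Definition bounded_coef_at (f : C -> C) (i : rat * rat * rat) (M : nat) :=
  bounded_at f (ratC i.1.1 i.1.2) (ratr i.2) M.

Lemma extendableP (f : X) : extendable W (set_val f) <->
  exists i M, crossing_disc i /\ bounded_coef_at (set_val f) i M.
Proof.
have fd := AF_holo (AF_val f); split=> [ef|[i [M [[Wa r0 nW] bf]]]].
- have [p [q [rho [M [h1 h2 h3 h4]]]]] := bounded_of_extendable oW fd ef.
  by exists (p, q, rho), M.
- exact: (extendable_of_bounded oW fd Wa r0 nW bf).
Qed.

Lemma tcoef_lin (f g : C -> C) (t : C) a k : holomorphic W f -> holomorphic W g -> W a ->
  tcoef (lin f t g) a k = tcoef f a k + t * tcoef g a k.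
Proof.
by move=> fd gd Wa; rewrite /tcoef (derive1n_lin _ _ oW fd gd Wa) mulrDl mulrA.
Qed.

(** The difference of the two functions is (s - t) g, so its coefficient bound can be divided by |s
    - t|. *)
Lemma bounded_coef_at_diff (f g : C -> C) (s t : R) i M N :
  holomorphic W f -> holomorphic W g -> crossing_disc i -> s != t ->
  bounded_coef_at (lin f (s%:C : C) g) i M -> bounded_coef_at (lin f (t%:C : C) g) i N ->
  exists K, bounded_coef_at g i K.
Proof.
move=> fd gd [Wa r0 _] st bM bN.
have st0 : 0 < `|s - t| by rewrite normr_gt0 subr_eq0.
exists (Num.truncn ((M%:R + N%:R) / `|s - t|)).+1 => k.
apply: (@le_trans _ _ ((M%:R + N%:R) / `|s - t|)); last by apply/ltW; rewrite truncnS_gt.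
rewrite ler_pdivlMr//; have := bM k; have := bN k.
have rk : 0 <= ratr i.2 ^+ k :> R by rewrite exprn_ge0// ltW.
rewrite !tcoef_lin//; move: (tcoef f _ _) (tcoef g _ _) (_ ^+ k) rk => u v r rk hN hM.
have -> : cmod v * r * `|s - t| = cmod ((u + s%:C * v) - (u + t%:C * v)) * r.
  have -> : (u + s%:C * v) - (u + t%:C * v) = (s - t)%:C * v by rewrite rmorphB /=; ring.
  by rewrite cmodM cmod_real; ring.
by have := ler_wpM2r rk (cmodB (u + s%:C * v) (u + t%:C * v)); rewrite mulrDl; lra.
Qed.

Lemma avoid_countable (A : set R) (d : R) : countable A -> 0 < d ->
  exists2 t, 0 < t < d & ~ A t.
Proof.
move=> cA d0; apply: contrapT => H.
have sub : [set` `]0, d[%R] `<=` A.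
  move=> t /=; rewrite in_itv /= => td; apply: contrapT => nAt.
  by apply: H; exists t.
have : lebesgue_measure [set` `]0, d[%R] = 0%E :> \bar R.
  exact/countable_lebesgue_measure0/(sub_countable _ cA)/subset_card_le.
rewrite lebesgue_measure_itv /= lte_fin d0 oppr0 adde0 => -[dE].
by rewrite dE ltxx in d0.
Qed.

(* On the line g + t f0, each of the countably many discs allows at most one
   value of t: two values would make f0 itself extendable. *)
Lemma nonextendable_dense (f0 : X) : ~ extendable W (set_val f0) ->
  dense (nonextendable W F I zpt).
Proof.
move=> nf0 O [g Og] oO.
have [gd fd] := (AF_holo (AF_val g), AF_holo (AF_val f0)).
pose mk (t : R) : X :=
  exist (fun h => h \in AF W F) (lin (set_val g) (t%:C : C) (set_val f0))
    (mem_set (AF_lin oW (t%:C : C) (AF_val g) (AF_val f0))).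
have [D Dok [Dg DO]] := AF_open_basis oO Og.
have [d d0 dO] : exists2 d : R, 0 < d & forall t, 0 < t < d -> O (mk t).
  have Hnear : \forall t \near (0 : R)^'+, (\bigcap_(x in [set` D])
      [set t : R | 0 < t -> x.1.1 (set_val (mk t) \- x.1.2) < x.2]) t.
    apply: filter_bigI => x xD.
    have [sx Ax x0] := Dok x xD; have gx := Dg x xD.
    have Adx := AF_sub oW (AF_val g) Ax.
    have p0 := AF_seminorm_ge0 sx (AF_val f0).
    (* The numerator is the room that [g] has in its ball; adding t f0 consumes at most t times the
       seminorm of f0, and the 1 keeps the denominator positive. *)
    pose eta := (x.2 - x.1.1 (set_val g \- x.1.2)) / (x.1.1 (set_val f0) + 1).
    have eta0 : 0 < eta by rewrite divr_gt0 ?subr_gt0// ltr_wpDl.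
    near=> t => t0.
    have teta : t < eta by near: t; exact: nbhs_right_lt.
    have E : set_val (mk t) \- x.1.2 = lin (set_val g \- x.1.2) (t%:C : C) (set_val f0).
      by apply/funext => w; exact: addrAC.
    rewrite /= E; apply: le_lt_trans (AF_seminorm_lin oW compz _ sx Adx (AF_val f0)) _.
    rewrite cmod_real gtr0_norm//.
    move: teta; rewrite /eta ltr_pdivlMr; last by rewrite ltr_wpDl.
    by nra.
  have [d d0 Hd] := Hnear; exists d => // t /andP[t0 td].
  apply: DO => x xD; apply: (Hd t _ t0 x xD t0).
  by rewrite /= sub0r normrN gtr0_norm.
pose bad (i : rat * rat * rat) := [set t : R | crossing_disc i /\
  exists M, bounded_coef_at (set_val (mk t)) i M].
have cbad : countable (\bigcup_i bad i).
  apply: bigcup_countable => [|i _]; first exact: countableP.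
  have [->|/set0P[s [vi [M bM]]]] := eqVneq (bad i) set0; first exact: countable0.
  apply: (@sub_countable _ _ _ [set s]); last exact: countable1.
  apply: subset_card_le => t [_ [N bN]]; apply: contrapT => /eqP ts.
  apply: nf0; apply/extendableP.
  have [K bK] := bounded_coef_at_diff gd fd vi ts bN bM.
  by exists i, K.
have [t td nt] := avoid_countable cbad d0.
exists (mk t); split; first exact: dO.
move=> /extendableP[i [M [vi bM]]]; apply: nt; exists i => //.
by split => //; exists M.
Unshelve. all: by end_near. Qed.

Lemma bounded_coef_at_open i M : crossing_disc i ->
  open [set f : X | ~ bounded_coef_at (set_val f) i M].
Proof.
move=> [Wa r0 _]; rewrite openE => f nb; rewrite /interior.
have [k Hk] : exists k, M%:R < cmod (tcoef (set_val f) (ratC i.1.1 i.1.2) k) * ratr i.2 ^+ k :> R.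
  apply: contrapT => H; apply: nb => k; rewrite leNgt; apply/negP => Hk.
  by apply: H; exists k.
set a := ratC i.1.1 i.1.2 in Wa Hk *; set r := ratr i.2 in r0 Hk *.
have rk : 0 < r ^+ k by exact: exprn_gt0.
have fk : 0 < k`!%:R :> R by rewrite ltr0n fact_gt0.
(* Half of the excess over [M], rescaled from the k-th weighted coefficient to the k-th
   derivative. *)
pose e := (cmod (tcoef (set_val f) a k) * r ^+ k - M%:R) / r ^+ k * k`!%:R / 2.
have e0 : 0 < e by rewrite /e !divr_gt0// mulr_gt0// divr_gt0// subr_gt0.
have := near_small_all oW compz f k F0 Wa e0.
apply: filterS => g hg bg.
have gd := AF_holo (@AF_val R W F I zpt g); have fd := AF_holo (AF_val f).
have := @tcoef_lin (set_val g) (set_val f) (-1) a k gd fd Wa.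
rewrite -subf_lin; move: hg; move: (set_val g \- set_val f) => h hg hE.
have tE : tcoef (set_val f) a k = tcoef (set_val g) a k - tcoef h a k.
  rewrite hE; move: (tcoef _ _ _) (tcoef _ _ _) => x y.
  by rewrite mulN1r opprB addrC subrK.
have := bg k; rewrite -/a -/r.
have th : cmod (tcoef h a k) * r ^+ k <= (cmod (tcoef (set_val f) a k) * r ^+ k - M%:R) / 2.
  rewrite /tcoef cmodM cmodV cmod_nat -ler_pdivlMr// ler_pdivrMr//.
  apply: le_trans hg _; rewrite /e -/(tcoef (set_val f) a k) le_eqVlt.
  by apply/orP; left; apply/eqP; ring.
have := ler_wpM2r (ltW rk) (cmodB (tcoef (set_val g) a k) (tcoef h a k)).
rewrite -tE mulrDl; lra.
Qed.

Lemma nonextendable_Gdelta : Gdelta (nonextendable W F I zpt).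
Proof.
(* Integers that code no pair, and pairs whose disc is not a crossing disc, contribute the whole
   space. *)
pose A (n : nat) : set X :=
  if choice.unpickle n is Some (i, M) then
    [set f | crossing_disc i -> ~ bounded_coef_at (set_val f) i M]
  else setT.
exists A => [n|].
- rewrite /A; case: choice.unpickle => [[i M]|]; last exact: openT.
  have [ci|nci] := pselect (crossing_disc i).
    rewrite (_ : [set f | _] = [set f : X | ~ bounded_coef_at (set_val f) i M]).
      exact: bounded_coef_at_open.
    by apply/seteqP; split=> f /=; [apply|move=> h _].
  by rewrite (_ : [set f | _] = setT); [exact: openT|by apply/seteqP; split=> // f _ /nci].
- apply/seteqP; split=> [f nf n _|f Af].
  + rewrite /A; case: choice.unpickle => [[i M]|//] ci bf.
    by apply: nf; apply/extendableP; exists i, M.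
  + move=> /extendableP[i [M [ci bf]]].
    have := Af (choice.pickle (i, M)) Logic.I; rewrite /A.
    by rewrite choice.pickleK; apply.
Qed.

End Nonextendable.

Theorem theorem6p3 (R : realType) (Omega : set (Cplx R)) (F : set nat)
    (I : set nat) (Om : nat -> set (Cplx R)) (z : nat -> Cplx R)
    (Omega_open : open Omega) (F_nonempty : F !=set0)
    (Om_z : component_points Omega I Om z) :
  nonextendable Omega F I z = set0 \/
  (dense (nonextendable Omega F I z) /\ Gdelta (nonextendable Omega F I z)).
Proof.
have [->|/set0P[f0 nf0]] := eqVneq (nonextendable Omega F I z) set0; first by left.
right; split; first exact: (nonextendable_dense Omega_open Om_z nf0).
exact: (nonextendable_Gdelta Omega_open F_nonempty Om_z).
Qed.
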